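(* Let $0<\alpha<1$ and $0<p<1$ be fixed, $q=1-p$. For $\lambda>0$, consider the binary trie built from $N\sim\mathrm{Po}(\lambda)$ random strings, where $N$ is Poisson with mean $\lambda$ and, given $N$, the strings are independent random infinite binary strings with independent bits each equal to $1$ with probability $p$. For $k\ge0$ let $X_k$ be the number of words $r\in\{0,1\}^k$ that are a prefix of at least two of the strings, $\bar X_k=X_k/2^k$, and let $\tilde F_\lambda(\alpha)=\max\{k:\bar X_k\ge\alpha\}$. Then for each $\lambda>0$ there is an integer $$k_\lambda=\log_{1/\sqrt{pq}}\lambda-\frac{|\ln(p/q)|}{2\ln^{3/2}(1/\sqrt{pq})}\,\Phi^{-1}(\alpha)\sqrt{\ln\lambda}+O(1)$$ such that $\mathbb{P}\big(\tilde F_\lambda(\alpha)\in\{k_\lambda,k_\lambda+1\}\big)\to1$ as $\lambda\to\infty$.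
   Context: $\Phi$ is the standard normal distribution function. The $O(1)$ term is bounded by a constant depending only on $\alpha$ and $p$. *)

(* Defs.v *)
From HB Require Import structures.
From mathcomp Require Import all_boot all_order all_algebra finmap.
From mathcomp Require Import all_classical all_reals all_analysis.

Set Implicit Arguments.
Unset Strict Implicit.
Unset Printing Implicit Defensive.

Import Order.TTheory GRing.Theory Num.Theory.
Import numFieldNormedType.Exports.

Local Open Scope classical_set_scope.
Local Open Scope ring_scope.

Definition Phi (R : realType) (x : R) : R :=
  fine (normal_prob (0 : R) 1 `]-oo, x]).

(* The junk value 0 is only taken outside ]0, 1[, the range of [Phi]. *)
Definition Phi_inv (R : realType) (a : R) : R := xget 0 [set x : R | Phi x = a].

Definition logb (R : realType) (b x : R) : R := ln x / ln b.

Definition cond_prob (R : realType) (d : measure_display)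
    (T : measurableType d) (P : probability T R) (B A : set T) : R :=
  fine (P (A `&` B)) / fine (P B).

(* [Q] is a plain set function so that the definition applies to
   [cond_prob P B]. *)
Definition mutually_independent (R : realType) (d d' : measure_display)
    (T : measurableType d) (T' : measurableType d') (I : choiceType)
    (Q : set T -> R) (X : I -> T -> T') : Prop :=
  forall (J : {fset I}) (A : I -> set T'), (forall i, measurable (A i)) ->
    Q (\bigcap_(i in [set` J]) (X i @^-1` A i)) =
    \prod_(i <- J) Q (X i @^-1` A i).

(* [xi i j] is the [j]-th bit of the [i]-th string; only the strings of index
   [i < N] are part of the model, so nothing is assumed on the others.  Joint
   independence of the bits over the pairs [(i, j)] means that the strings are
   independent and that each of them has independent bits. *)
Definition poisson_random_strings (R : realType) (d : measure_display)
    (T : measurableType d) (P : probability T R) (lambda p : R)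
    (N : {RV P >-> nat}) (xi : nat -> nat -> {RV P >-> bool}) : Prop :=
  (forall n : nat, P (N @^-1` [set n]) = (poisson_pmf lambda n)%:E) /\
  (forall n : nat,
     mutually_independent (cond_prob P (N @^-1` [set n]))
       (fun ij : 'I_n * nat => xi ij.1 ij.2 : T -> bool) /\
     (forall (i : 'I_n) (j : nat),
        cond_prob P (N @^-1` [set n]) (xi i j @^-1` [set true]) = p)).

Definition is_prefix (k : nat) (r : k.-tuple bool) (s : nat -> bool) : bool :=
  [forall j : 'I_k, s j == tnth r j].

(* Number of words of length [k] that are a prefix of at least two of the
   strings [s 0, ..., s (n - 1)], equal strings being counted separately. *)
Definition shared_prefixes (n : nat) (s : nat -> nat -> bool) (k : nat) : nat :=
  #|[pred r : k.-tuple bool | (2 <= #|[pred i : 'I_n | is_prefix r (s i)]|)%N]|.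

Definition fill_ratio (R : realType) (n : nat) (s : nat -> nat -> bool)
    (k : nat) : R :=
  (shared_prefixes n s k)%:R / 2 ^+ k.

Definition is_max (A : set nat) (m : nat) : Prop := A m /\ ubound A m.

(* A predicate rather than a function, since the maximum does not exist when
   [n < 2] (for [0 < alpha]) and might not exist when two of the strings are
   equal. *)
Definition is_fillup_level (R : realType) (alpha : R) (n : nat)
    (s : nat -> nat -> bool) (m : nat) : Prop :=
  is_max [set k : nat | alpha <= fill_ratio R n s k] m.

(* Main.v *)
(* Read a word of length k as a +-1 walk ending at s: its probability is exp (- ell k + h s),
   with ell = - ln (p q) / 2 and h = |ln (p / q)| / 2.  Hence the mean fill ratio
   at level k is the average over simple random walks S_k of
   psi (exp (ln lambda - ell k + h S_k)), where psi x = 1 - (1 + x) exp (- x) is the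
   probability that a Poisson variable of mean x is at least 2.

   - Poissonization makes the counts of distinct words independent, so the
     variance of the fill ratio is at most 2^-k and Chebyshev's inequality applies.
   - The function psi \o exp is a smoothed step, so the mean is
     Phi ((ln lambda - ell k) / (h sqrt (k + 1))) + O(1 / sqrt k) by a
     Berry-Esseen bound for the simple random walk, obtained by Stein's method.
     In terms of rho = sqrt (ln lambda / ell), it crosses alpha within O(1) of
     k = rho^2 - (h Phi^-1(alpha) / ell) rho, which is the stated expansion.
   - Near the crossing, consecutive levels have means at least c / sqrt k apart,
     because with probability of order 1 / sqrt k the argument of psi lies in a
     fixed compact interval.  So with delta = rho^-2 there is K with mean
     >= alpha + delta at level K and <= alpha - delta at level K + 2; the fill
     ratio being nonincreasing in k, the fill-up level is K or K + 1 with high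
     probability. *)
Require Import Defs.
From HB Require Import structures.
From mathcomp Require Import all_boot all_order all_algebra finmap.
From mathcomp Require Import all_classical all_reals all_analysis.
From mathcomp Require Import ring lra.

Set Implicit Arguments.
Unset Strict Implicit.
Unset Printing Implicit Defensive.

Import Order.TTheory GRing.Theory Num.Theory.
Import numFieldNormedType.Exports.

Local Open Scope classical_set_scope.
Local Open Scope ring_scope.

(** * Simple random walk *)

(* The mean of [g S_n] for the simple random walk [S_n] started at 0. *)
Fixpoint walk (R : realType) (n : nat) (g : R -> R) : R :=
  if n is m.+1 then walk m (fun s => (g (s + 1) + g (s - 1)) / 2) else g 0.

Lemma eq_walk (R : realType) n (f g : R -> R) : f =1 g -> walk n f = walk n g.
Proof. by move=> /funext ->. Qed.

Lemma walk_cst (R : realType) n (c : R) : walk n (fun=> c) = c.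
Proof. by elim: n => //= n IH; rewrite -[RHS]IH; apply: eq_walk => s; field. Qed.

Lemma walkD (R : realType) n (f g : R -> R) :
  walk n (fun s => f s + g s) = walk n f + walk n g.
Proof.
by elim: n f g => //= n IH f g; rewrite -IH; apply: eq_walk => s; field.
Qed.

Lemma walkZ (R : realType) n (c : R) (g : R -> R) :
  walk n (fun s => c * g s) = c * walk n g.
Proof. by elim: n g => //= n IH g; rewrite -IH; apply: eq_walk => s; field. Qed.

Lemma walkB (R : realType) n (f g : R -> R) :
  walk n (fun s => f s - g s) = walk n f - walk n g.
Proof.
rewrite -[- walk n g]mulN1r -walkZ -walkD.
by apply: eq_walk => s; rewrite mulN1r.
Qed.

Lemma le_walk (R : realType) n (f g : R -> R) :
  (forall s, f s <= g s) -> walk n f <= walk n g.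
Proof.
elim: n f g => //= n IH f g fg; apply: IH => s.
by rewrite ler_pM2r ?invr_gt0 ?ltr0n// lerD.
Qed.

Lemma ler_norm_walk (R : realType) n (f : R -> R) :
  `|walk n f| <= walk n (fun s => `|f s|).
Proof.
rewrite ler_norml; apply/andP; split; last by apply: le_walk => s; rewrite ler_norm.
rewrite -mulN1r -walkZ; apply: le_walk => s; rewrite mulN1r.
by rewrite lerNl -normrN ler_norm.
Qed.

(** Induction on the last step: averaging [s * g s] over it leaves [s] times the average of [g] plus
    half a difference of [g]. The induction hypothesis turns the first term into [n.+1] further
    copies of the second. *)
Lemma walk_stein (R : realType) n (g : R -> R) :
  walk n.+1 (fun s => s * g s) =
  n.+1%:R * walk n (fun s => (g (s + 1) - g (s - 1)) / 2).
Proof.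
elim: n g => [|n IH] g; first by rewrite /=; field.
have -> : walk n.+2 (fun s => s * g s) =
    walk n.+1 (fun s => s * ((g (s + 1) + g (s - 1)) / 2)) +
    walk n.+1 (fun s => (g (s + 1) - g (s - 1)) / 2).
  by rewrite -walkD; apply: (@eq_walk _ n.+1) => s; field.
rewrite IH -[in RHS]natr1 mulrDl mul1r; congr (_ * _ + _).
by apply: (@eq_walk _ n) => s; rewrite !addrK !subrK; field.
Qed.

Lemma walk_sqr (R : realType) n : walk n (fun s => s * s) = n%:R :> R.
Proof.
case: n => [|n]; first by rewrite /= mul0r.
rewrite (walk_stein n id).
rewrite (@eq_walk _ _ _ (fun=> 1)) ?walk_cst ?mulr1// => s.
by rewrite /=; field.
Qed.

(** The second moment is [n], and [|s| <= s^2 / (2 r) + r / 2] with [r = sqrt n] replaces the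
    Cauchy-Schwarz inequality. *)
Lemma walk_norm (R : realType) n :
  walk n (fun s => `|s|) <= Num.sqrt n%:R :> R.
Proof.
case: n => [|n]; first by rewrite /= normr0 sqrtr_ge0.
set r := Num.sqrt _; have r0 : 0 < r by rewrite sqrtr_gt0 ltr0n.
have r2 : r * r = n.+1%:R by rewrite -expr2 sqr_sqrtr ?ler0n.
suff : walk n.+1 (fun s : R => `|s|) <=
    walk n.+1 (fun s : R => (2 * r)^-1 * (s * s) + r / 2).
  move=> /le_trans; apply; rewrite walkD walkZ walk_cst walk_sqr -r2.
  by rewrite invfM -!mulrA (mulrA r^-1) mulVf ?gt_eqF// mul1r; lra.
apply: le_walk => s; have -> : s * s = `|s| * `|s| by rewrite -normrM ger0_norm// -expr2 sqr_ge0.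
rewrite -subr_ge0.
have -> : (2 * r)^-1 * (`|s| * `|s|) + r / 2 - `|s| = (2 * r)^-1 * (`|s| - r) ^+ 2.
  by field; rewrite gt_eqF.
by rewrite mulr_ge0 ?sqr_ge0// invr_ge0 mulr_ge0// ltW.
Qed.

(* Stein's identity applied to a bounded increasing function of [s - y]. *)
Lemma walk_conc (R : realType) n (c y : R) : 0 < c ->
  walk n (fun s => expR (- (c * `|s - y|))) <=
  2 / (1 - expR (- c)) / Num.sqrt n.+1%:R.
Proof.
move=> c0; set r := Num.sqrt _; have r0 : 0 < r by rewrite sqrtr_gt0 ltr0n.
have r2 : r * r = n.+1%:R by rewrite -expr2 sqr_sqrtr ?ler0n.
set b := 1 - expR (- c).
have b0 : 0 < b by rewrite subr_gt0 expR_lt1 oppr_lt0.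
(* The derivative of this [g] is [c * expR (- (c * |s - y|))], so its increments control the average
   to be bounded, while [|g| <= 1]. *)
pose g (s : R) := if s <= y then expR (c * (s - y)) - 1 else 1 - expR (- (c * (s - y))).
have e1 s : s <= y -> expR (c * (s - y)) <= 1.
  by move=> sy; rewrite expR_le1 pmulr_rle0// subr_le0.
have e2 s : y <= s -> expR (- (c * (s - y))) <= 1.
  by move=> sy; rewrite expR_le1 oppr_le0 pmulr_rge0// subr_ge0.
have g1 s : `|g s| <= 1.
  rewrite /g ler_norml; case: ifPn => [sy|]; last rewrite -ltNge => sy.
    have := expR_gt0 (c * (s - y)).
    have : expR (c * (s - y)) <= 1 by rewrite e1.
    lra.
  have := expR_gt0 (- (c * (s - y))).
  have : expR (- (c * (s - y))) <= 1 by rewrite e2// ltW.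
  lra.
have gmono s t : s <= t -> g s <= g t.
  move=> st; rewrite /g; case: ifPn => sy; case: ifPn => ty.
  - by rewrite lerD2r ler_expR ler_pM2l// lerD2r.
  - rewrite -ltNge in ty.
    have : expR (c * (s - y)) <= 1 by rewrite e1.
    have : expR (- (c * (t - y))) <= 1 by rewrite e2// ltW.
    lra.
  - by move: sy; rewrite (le_trans st ty).
  - by rewrite lerD2l lerN2 ler_expR lerN2 ler_pM2l// lerD2r.
(* Of the interval from [s - 1] to [s + 1], only the half pointing away from [y] is kept: there a
   single formula for [g] applies. *)
have gstep s : b * expR (- (c * `|s - y|)) <= g (s + 1) - g (s - 1).
  have [sy|sy] := leP s y.
    apply: (@le_trans _ _ (g s - g (s - 1))); last by rewrite lerD2r gmono// lerDl.
    rewrite /g sy (le_trans _ sy) ?gerBl//.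
    rewrite ler0_norm ?subr_le0// mulrN opprK opprB addrA subrK.
    rewrite (_ : c * (s - 1 - y) = - c + c * (s - y)); last by ring.
    by rewrite expRD /b mulrBl mul1r.
  apply: (@le_trans _ _ (g (s + 1) - g s)); last by rewrite lerD2l lerN2 gmono// gerBl.
  rewrite /g !leNgt sy (lt_le_trans sy) ?lerDl//=.
  rewrite gtr0_norm ?subr_gt0//.
  rewrite (_ : - (c * (s + 1 - y)) = - c - c * (s - y)); last by ring.
  by rewrite expRD /b mulrBl mul1r; lra.
have A : n.+1%:R * walk n (fun s => (g (s + 1) - g (s - 1)) / 2) <= r.
  rewrite -walk_stein; apply: le_trans (walk_norm R n.+1); apply: le_walk => s.
  by rewrite (le_trans (ler_norm _))// normrM ler_piMr.
have B : (b / 2) * walk n (fun s => expR (- (c * `|s - y|))) <=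
    walk n (fun s => (g (s + 1) - g (s - 1)) / 2).
  by rewrite -walkZ; apply: le_walk => s; rewrite mulrAC ler_pM2r ?invr_gt0.
rewrite ler_pdivlMr// ler_pdivlMr//.
have : r * (r * ((b / 2) * walk n (fun s => expR (- (c * `|s - y|))))) <= r.
  by rewrite mulrA r2 (le_trans _ A)// ler_pM2l ?ltr0n.
by rewrite -[leRHS]mulr1 ler_pM2l//; lra.
Qed.

(** * Normal distribution *)

Lemma mean_value (R : realType) (f df : R -> R) (a b : R) : a <= b ->
  (forall x : R, is_derive x 1 f (df x)) ->
  exists2 c, a <= c <= b & f b - f a = df c * (b - a).
Proof.
move=> ab fdf; have [|c] := @MVT_segment R f df a b ab (fun x _ => fdf x).
  apply: continuous_subspaceT => x.
  by apply: differentiable_continuous; apply/derivable1_diffP; apply: ex_derive.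
- by rewrite in_itv/=; exists c.
Qed.

Definition gauss (R : realType) (x : R) : R := normal_pdf (0 : R) 1 x.

Lemma gaussE (R : realType) (x : R) :
  gauss x = normal_peak (1 : R) * expR (- (x ^+ 2 / 2)).
Proof.
by rewrite /gauss normal_pdfE ?oner_neq0// /normal_fun subr0 expr1n mulNr.
Qed.

Lemma gauss_gt0 (R : realType) (x : R) : 0 < gauss x.
Proof. by rewrite gaussE mulr_gt0 ?expR_gt0// normal_peak_gt0// oner_neq0. Qed.

Lemma gauss_le (R : realType) (x y : R) : `|x| <= `|y| -> gauss y <= gauss x.
Proof.
move=> xy; rewrite !gaussE ler_pM2l ?normal_peak_gt0 ?oner_neq0//.
rewrite ler_expR lerN2 ler_pM2r// -[x ^+ 2]real_normK ?num_real//.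
by rewrite -[y ^+ 2]real_normK ?num_real// lerXn2r ?nnegrE.
Qed.

Lemma gaussN (R : realType) (x : R) : gauss (- x) = gauss x.
Proof. by apply/eqP; rewrite eq_le !gauss_le// normrN. Qed.

Lemma is_derive_gauss (R : realType) (x : R) :
  is_derive x 1 (@gauss R) (- x * gauss x).
Proof.
rewrite (_ : @gauss R = fun x => normal_peak (1 : R) * expR (- (x ^+ 2 / 2))); last first.
  by apply/funext => y; rewrite gaussE.
apply: is_derive_eq.
by rewrite /GRing.scale/=; field.
Qed.

Lemma is_derive_Phi (R : realType) (x : R) : is_derive x 1 (@Phi R) (gauss x).
Proof.
have := @continuous_FTC1 R (@gauss R) -oo%O x (x + 1).
case=> //=.
- by rewrite ltrDl.
- apply: integrableS (@integrable_normal_pdf R 0 1) => //.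
- exact: ltNyr.
- exact: (@continuous_normal_pdf R 0 1 (oner_neq0 _)).
- by move=> D E; apply: DeriveDef => //; rewrite -derive1E.
Qed.

(** The identity as a random variable under the normal law: its distribution function is [Phi],
    which gives the limits of [Phi] at both infinities. *)
Definition idR (R : realType) : measurableTypeR R -> R := idfun.

HB.instance Definition _ (R : realType) :=
  @isMeasurableFun.Build _ _ _ _ (@idR R) (@measurable_id _ _ setT).

Lemma Phi_cvg_pinfty (R : realType) : @Phi R x @[x --> +oo] --> (1 : R).
Proof.
have := @cvg_cdfy1 _ _ R (@normal_prob R 0 1) (@idR R : {RV (@normal_prob R 0 1) >-> R}).
move=> /fine_cvg; apply: cvg_trans.
by apply: near_eq_cvg; near=> x.
Unshelve. all: end_near. Qed.

Lemma Phi_cvg_ninfty (R : realType) : @Phi R x @[x --> -oo] --> (0 : R).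
Proof.
have := @cvg_cdfNy0 _ _ R (@normal_prob R 0 1) (@idR R : {RV (@normal_prob R 0 1) >-> R}).
move=> /fine_cvg; apply: cvg_trans.
by apply: near_eq_cvg; near=> x.
Unshelve. all: end_near. Qed.

Lemma Phi_ge0 (R : realType) (x : R) : 0 <= Phi x.
Proof. by rewrite fine_ge0. Qed.

Lemma Phi_le1 (R : realType) (x : R) : Phi x <= 1.
Proof.
rewrite -[leRHS]/(fine (1%:E : \bar R)) fine_le//.
- by rewrite (@fin_num_measure _ _ _ (@normal_prob R 0 1)).
- exact: (@probability_le1 _ _ _ (@normal_prob R 0 1)).
Qed.

Lemma Phi_mean (R : realType) (x y : R) : x <= y ->
  exists2 c, x <= c <= y & Phi y - Phi x = gauss c * (y - x).
Proof. by move=> xy; apply: mean_value => // t; exact: is_derive_Phi. Qed.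

Lemma Phi_le (R : realType) (x y : R) : x <= y -> Phi x <= Phi y.
Proof.
move=> xy; have [c _ E] := Phi_mean xy.
by rewrite -subr_ge0 E mulr_ge0 ?subr_ge0// ltW// gauss_gt0.
Qed.

(** As [gauss] is even, [Phi x + Phi (- x)] has derivative 0; its constant value is read off at
    infinity. *)
Lemma PhiN (R : realType) (x : R) : Phi (- x) = 1 - Phi x.
Proof.
pose F (x : R) := Phi x + Phi (- x).
have FE y : 0 <= y -> F y = F 0.
  move=> y0; have [|c _] := @mean_value R F (fun=> 0) 0 y y0.
    move=> z; rewrite /F.
    have h1 := is_derive_Phi z.
    have h2 := is_derive_Phi (- z).
    have h3 : is_derive z (1 : R) (fun z : R => - z) (- 1) by apply: is_derive_eq.
    have h4 := @is_derive1_comp R (@Phi R) (fun z : R => - z) z _ _ h2 h3.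
    apply: is_derive_eq.
    by rewrite gaussN; ring.
  by rewrite mul0r => /subr0_eq.
suff F0 : F 0 = 1.
  have [x0|x0] := leP 0 x; first by have := FE _ x0; rewrite F0 /F; lra.
  by have := FE (- x); rewrite oppr_ge0 ltW// => /(_ isT); rewrite F0 /F opprK; lra.
have : F x @[x --> +oo] --> (1 + 0 : R).
  apply: cvgD; first exact: Phi_cvg_pinfty.
  by have := @Phi_cvg_ninfty R; rewrite cvgNy_compNP.
rewrite addr0 => /cvg_lim <-//; apply/esym/cvg_lim => //.
apply: (@cvg_trans _ (F 0 @[x --> +oo%R])); last exact: cvg_cst.
apply: near_eq_cvg; near=> y; apply/esym/FE; near: y.
exact: nbhs_pinfty_ge.
Unshelve. all: end_near. Qed.

(** For [y >= x] the function [gauss y + x * Phi y] has derivative [(x - y) * gauss y <= 0]; compare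
    its value at [x] with the limit of [x * Phi y] at infinity. *)
Lemma Phi_mills (R : realType) (x : R) : 0 <= x -> x * Phi (- x) <= gauss x.
Proof.
move=> x0.
have H y : x <= y -> x * Phi y <= gauss x + x * Phi x.
  move=> xy.
  pose H (y : R) := gauss y + x * Phi y.
  have [|c /andP[xc _]] := @mean_value R H (fun y => - y * gauss y + x * gauss y) x y xy.
    move=> z; have h1 := is_derive_Phi z; have h2 := is_derive_gauss z.
    by apply: is_derive_eq; rewrite /GRing.scale/=; ring.
  rewrite /H => E.
  have : (- c * gauss c + x * gauss c) * (y - x) <= 0.
    rewrite -mulrDl mulr_le0_ge0 ?subr_ge0// mulr_le0_ge0//; last by rewrite ltW// gauss_gt0.
    by rewrite addrC subr_le0.
  have := gauss_gt0 y; rewrite -E; lra.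
rewrite PhiN; suff : x * 1 <= gauss x + x * Phi x by lra.
have cx : x * Phi y @[y --> +oo] --> x * 1.
  by apply: cvgMl_tmp; exact: Phi_cvg_pinfty.
rewrite -(cvg_lim _ cx)//; apply: limr_le; first exact: cvgP cx.
by near=> y; apply: H; near: y; exact: nbhs_pinfty_ge (num_real x).
Unshelve. all: end_near. Qed.

(** Mills' ratio of the lower tail, a solution of [m' = 1 + w * m] and hence the building block of
    the Stein solution. *)
Definition mills (R : realType) (w : R) : R := Phi w / gauss w.

Lemma mills_ge0 (R : realType) (w : R) : 0 <= mills w.
Proof. by rewrite divr_ge0 ?Phi_ge0// ltW// gauss_gt0. Qed.

Lemma mills_le1 (R : realType) (w : R) : w <= 0 -> - w * mills w <= 1.
Proof.
move=> w0; rewrite /mills mulrA ler_pdivrMr ?gauss_gt0// mul1r -gaussN.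
by rewrite -{2}[w]opprK Phi_mills// oppr_ge0.
Qed.

Lemma is_derive_mills (R : realType) (w : R) :
  is_derive w 1 (@mills R) (1 + w * mills w).
Proof.
have h1 := is_derive_Phi w; have h2 := is_derive_gauss w.
have g0 : gauss w != 0 by rewrite gt_eqF// gauss_gt0.
have h3 := is_deriveV g0.
have E : @mills R = @Phi R * (fun x => (gauss x)^-1) by apply/funext.
rewrite [X in is_derive _ _ X _]E; apply: is_derive_eq.
by rewrite /GRing.scale/= /mills; field.
Qed.

Lemma mills_le (R : realType) (w : R) : w <= 0 -> mills w <= mills 0.
Proof.
move=> w0; have [|c /andP[wc c0] E] := @mean_value R (@mills R) (fun w => 1 + w * mills w) w 0 w0.
  by move=> z; exact: is_derive_mills.
rewrite -subr_ge0 E mulr_ge0 ?subr_ge0//.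
by have := mills_le1 c0; lra.
Qed.

(** * Stein's method and the Berry-Esseen bound *)

(* The bounded solution of the Stein equation
   [f' w - w * f w = (w <= x)%R%:R - Phi x]. *)
Definition stein (R : realType) (x w : R) : R :=
  if w <= x then Phi (- x) * mills w else Phi x * mills (- w).

Lemma stein_left (R : realType) (x w : R) :
  w <= x -> stein x w = Phi (- x) * mills w.
Proof. by rewrite /stein => ->. Qed.

(** Reflection swaps the two branches, which agree at [w = x], so later estimates are proved on the
    branch [w <= x] only. *)
Lemma steinN (R : realType) (x w : R) : stein (- x) (- w) = stein x w.
Proof.
rewrite /stein lerN2 !opprK; case: (ltgtP w x) => // ->.
by rewrite /mills gaussN mulrCA mulrA.
Qed.

Lemma stein_ge0 (R : realType) (x w : R) : 0 <= stein x w.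
Proof. by rewrite /stein; case: ifP => _; rewrite mulr_ge0 ?Phi_ge0 ?mills_ge0. Qed.

(** In all cases [stein x w <= mills (- |w|)]: for [0 < w <= x] because [Phi (- x) <= Phi (- w)],
    for [w <= 0] because [Phi (- x) <= 1]. Mills' inequality does the rest. *)
Lemma stein_bounds (R : realType) (x w : R) :
  stein x w <= mills 0 /\ `|w * stein x w| <= 1.
Proof.
wlog wx : x w / w <= x => [H|].
  have [/H//|xw] := leP w x.
  by have := H (- x) (- w); rewrite lerN2 ltW// steinN mulNr normrN; apply.
have [w0|w0] := leP w 0.
  have S : stein x w <= mills w.
    by rewrite stein_left// ler_piMl ?mills_ge0 ?Phi_le1.
  split; first exact: le_trans S (mills_le w0).
  rewrite normrM ler0_norm// ger0_norm ?stein_ge0//.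
  by apply: le_trans (mills_le1 w0); rewrite ler_wpM2l// oppr_ge0.
have S : stein x w <= mills (- w).
  rewrite stein_left// /mills gaussN mulrA ler_pM2r ?invr_gt0 ?gauss_gt0//.
  rewrite -[leRHS]mulr1 ler_pM ?Phi_ge0 ?Phi_le1//.
  by rewrite Phi_le// lerN2.
have Nw0 : - w <= 0 by rewrite oppr_le0 ltW.
split; first exact: le_trans S (mills_le Nw0).
rewrite normrM gtr0_norm// ger0_norm ?stein_ge0//.
by apply: le_trans (mills_le1 Nw0); rewrite opprK ler_wpM2l// ltW.
Qed.

Lemma stein_mean (R : realType) (x a b : R) : a <= b -> b <= x ->
  exists2 c, a <= c <= b &
    stein x b - stein x a = (c * stein x c + Phi (- x)) * (b - a).
Proof.
move=> ab bx.
have [|c /andP[ac cb] E] := @mean_value R (fun w => Phi (- x) * mills w)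
    (fun w => Phi (- x) * (1 + w * mills w)) a b ab.
  move=> w; have h := is_derive_mills w.
  by apply: is_derive_eq; rewrite /GRing.scale/=; ring.
exists c; first by rewrite ac.
by rewrite !stein_left ?(le_trans cb)// ?(le_trans ab)// E; ring.
Qed.

Lemma stein_slope (R : realType) (x w : R) : `|w * stein x w + Phi (- x)| <= 2.
Proof.
have [_ h] := stein_bounds x w; rewrite (le_trans (ler_normD _ _))//.
have := Phi_le1 (- x); have := Phi_ge0 (- x) => p0 p1.
by rewrite (ger0_norm p0); lra.
Qed.

(** The slope is at most 2 on each side of [x]; an interval containing the kink is cut at [x]. *)
Lemma stein_lipschitz (R : realType) (x a b : R) :
  `|stein x b - stein x a| <= 2 * `|b - a|.
Proof.
have L (y u v : R) : u <= v -> v <= y -> `|stein y v - stein y u| <= 2 * (v - u).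
  move=> uv vy; have [c _ ->] := stein_mean uv vy.
  rewrite normrM (ger0_norm (_ : 0 <= v - u)) ?subr_ge0//.
  by rewrite ler_wpM2r ?subr_ge0// stein_slope.
wlog ab : a b / a <= b => [H|].
  have [/H//|/ltW/H] := leP a b.
  by rewrite distrC (distrC a).
rewrite (ger0_norm (_ : 0 <= b - a)) ?subr_ge0//.
have [bx|xb] := leP b x; first exact: L.
have [ax|xa] := leP a x; last first.
  have := @L (- x) (- b) (- a); rewrite !steinN !lerN2 opprK distrC => /(_ ab (ltW xa)).
  by lra.
rewrite (_ : stein x b - stein x a = (stein x b - stein x x) + (stein x x - stein x a)); last by ring.
rewrite (le_trans (ler_normD _ _))//.
have := L x a x ax (lexx _).
have := @L (- x) (- b) (- x); rewrite !steinN !lerN2 opprK distrC => /(_ (ltW xb) (lexx _)).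
lra.
Qed.

Lemma stein_drift (R : realType) (x w c e : R) : `|c - w| <= e ->
  `|c * stein x c - w * stein x w| <= e * (mills 0 + 2 * `|w|).
Proof.
move=> cw; rewrite (_ : c * stein x c - w * stein x w =
  (c - w) * stein x c + w * (stein x c - stein x w)); last by ring.
rewrite (le_trans (ler_normD _ _))// !normrM (ger0_norm (stein_ge0 _ _)) mulrDr lerD//.
  by rewrite ler_pM ?stein_ge0// (stein_bounds x c).1.
rewrite (_ : e * (2 * `|w|) = `|w| * (2 * e)); last by ring.
by rewrite ler_wpM2l// (le_trans (stein_lipschitz x w c))// ler_wpM2l.
Qed.

(** Away from [x] the symmetric difference quotient is the derivative at a point within [e] of [w],
    and the Stein equation is compared at the two points. If the kink at [x] may lie within [e],
    each term is bounded separately, by 2 + 1 + 1 = 4. *)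
Lemma stein_increment (R : realType) (x w e : R) : 0 < e ->
  `|(stein x (w + e) - stein x (w - e)) / (2 * e) -
    (w * stein x w + (w <= x)%R%:R - Phi x)| <=
  e * (mills 0 + 2 * `|w|) + 4 * (`|w - x| <= e)%R%:R.
Proof.
move=> e0; set K := e * _; have K0 : 0 <= K.
  by rewrite mulr_ge0 ?(ltW e0)// addr_ge0 ?mills_ge0// mulr_ge0.
have ee : w - e <= w + e by lra.
have e20 : 0 < 2 * e by lra.
have [wxe|wxe] := boolP (`|w - x| <= e).
  rewrite mulr1.
  have h1 : `|(stein x (w + e) - stein x (w - e)) / (2 * e)| <= 2.
    rewrite normrM normfV (gtr0_norm e20) ler_pdivrMr//.
    have := stein_lipschitz x (w - e) (w + e).
    by rewrite (_ : w + e - (w - e) = 2 * e) ?(gtr0_norm e20)//; ring.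
  have [_ h2] := stein_bounds x w.
  have h3 : `|(w <= x)%R%:R - Phi x| <= 1.
    have := Phi_ge0 x; have := Phi_le1 x; rewrite ler_norml.
    by case: (w <= x) => /=; lra.
  rewrite -addrA opprD addrA.
  rewrite (le_trans (ler_normB _ _))// (le_trans (lerD (ler_normB _ _) h3))//.
  lra.
rewrite mulr0 addr0; move: wxe; rewrite ler_norml negb_and -!ltNge => /orP[wx|xw].
  have wx' : w <= x by lra.
  have wex : w + e <= x by lra.
  have [c /andP[c1 c2] ->] := stein_mean ee wex.
  rewrite (_ : w + e - (w - e) = 2 * e); last by ring.
  rewrite mulfK ?gt_eqF// wx' PhiN.
  rewrite (_ : _ - _ = c * stein x c - w * stein x w); last by rewrite /=; ring.
  by apply: stein_drift; rewrite ler_norml; lra.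
have wx' : (w <= x) = false by apply/negbTE; rewrite -ltNge; lra.
have [||c /andP[c1 c2]] := @stein_mean R (- x) (- (w + e)) (- (w - e)).
- lra.
- lra.
rewrite !steinN !opprK => E; rewrite -[c]opprK steinN in E.
rewrite -(opprB (stein x (w - e))) {}E.
rewrite (_ : - (w - e) + (w + e) = 2 * e); last by ring.
rewrite mulNr mulfK ?gt_eqF// wx'.
rewrite (_ : _ - _ = (- c) * stein x (- c) - w * stein x w); last by rewrite /=; ring.
by apply: stein_drift; rewrite ler_norml; lra.
Qed.

Lemma sqrtn_gt0 (R : realType) n : 0 < Num.sqrt n.+1%:R :> R.
Proof. by rewrite sqrtr_gt0 ltr0n. Qed.

Lemma sqrtn_sqr (R : realType) n :
  Num.sqrt n.+1%:R * Num.sqrt n.+1%:R = n.+1%:R :> R.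
Proof. by rewrite -expr2 sqr_sqrtr ?ler0n. Qed.

Definition conc_const (R : realType) : R := 2 / (1 - expR (- (1 : R))).

Lemma conc_const_gt0 (R : realType) : 0 < conc_const R.
Proof. by rewrite divr_gt0// subr_gt0 expR_lt1 oppr_lt0. Qed.

Lemma walk_near (R : realType) n (y : R) :
  walk n (fun s => (`|s - y| <= 1)%R%:R) <=
  expR 1 * (conc_const R / Num.sqrt n.+1%:R).
Proof.
have := @walk_conc R n 1 y ltr01; rewrite -/(conc_const R) => h.
rewrite -(ler_pM2l (expR_gt0 (1 : R))) in h.
apply: le_trans h; rewrite -walkZ; apply: le_walk => s.
rewrite -expRD mul1r; case: (leP `|s - y| 1) => [sy|_]; last exact: expR_ge0.
by apply: le_trans (expR_ge1Dx _); rewrite lerDl subr_ge0.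
Qed.

Definition be_const (R : realType) : R :=
  2 * (mills 0 + 2) + 4 * (expR 1 * conc_const R).

Lemma be_const_gt0 (R : realType) : 0 < be_const R.
Proof.
have := mills_ge0 (0 : R); have := expR_gt0 (1 : R); have := conc_const_gt0 R.
move=> h1 h2 h3; have : 0 < expR 1 * conc_const R by rewrite mulr_gt0.
by rewrite /be_const; lra.
Qed.

(* The walk has [n] steps but is normalized by [sqrt (n + 1)], as [walk_stein]
   turns a moment of [S_(n+1)] into a difference quotient along [S_n]. *)
Lemma walk_berry_esseen (R : realType) n (y : R) :
  `|walk n (fun s => (s <= y)%R%:R) - Phi (y / Num.sqrt n.+1%:R)| <=
  be_const R / Num.sqrt n.+1%:R.
Proof.
set r := Num.sqrt _; have r0 : 0 < r by exact: sqrtn_gt0.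
have r2 : r * r = n.+1%:R by exact: sqrtn_sqr.
have rn0 : r != 0 by rewrite gt_eqF.
set x := y / r; pose e := r^-1; have e0 : 0 < e by rewrite invr_gt0.
(* [V] averages [w * stein x w] over the two positions after one more step, and [D] is the
   difference quotient that [walk_stein] pairs with it; so [V] and [D] have the same mean. *)
pose V (s : R) := ((s / r + e) * stein x (s / r + e) + (s / r - e) * stein x (s / r - e)) / 2.
pose D (s : R) := (stein x (s / r + e) - stein x (s / r - e)) / (2 * e).
have sp s : (s + 1) / r = s / r + e by rewrite mulrDl div1r.
have sm s : (s - 1) / r = s / r - e by rewrite mulrBl div1r.
have VD : walk n (fun s => D s - V s) = 0.
  rewrite walkB; apply/eqP; rewrite subr_eq0; apply/eqP.
  have := walk_stein n (fun s => stein x (s / r)); rewrite -r2 /= => E.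
  apply: (mulfI rn0); rewrite -!walkZ.
  rewrite (@eq_walk _ n (fun s => r * V s)
    (fun s => ((s + 1) * stein x ((s + 1) / r) + (s - 1) * stein x ((s - 1) / r)) / 2)).
    rewrite E -walkZ; apply: (@eq_walk _ n) => s; rewrite !(sp, sm) /D /e.
    by field.
  by move=> s; rewrite !(sp, sm) /V /e; field.
pose W (s : R) := s / r * stein x (s / r).
pose U (s : R) := W s + (s / r <= x)%R%:R - Phi x - D s.
(* [U] is the error in the Stein equation at [S_n], and [V - W] the cost of passing from [S_(n+1)]
   back to [S_n]. *)
have -> : walk n (fun s => (s <= y)%R%:R) - Phi x = walk n (fun s => U s + (V s - W s)).
  rewrite -[RHS]addr0 -VD -walkD -[X in _ - X](walk_cst n) -walkB.
  by apply: eq_walk => s; rewrite /U ler_pM2r ?invr_gt0//; ring.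
pose N (s : R) : R := (`|s - y| <= 1)%R%:R.
have boundU s : `|U s| <= e * (mills 0 + 2 * `|s / r|) + 4 * N s.
  rewrite /U -normrN opprB; apply: le_trans (stein_increment x (s / r) e0) _.
  rewrite /N (_ : (`|s / r - x| <= e) = (`|s - y| <= 1))//.
  by rewrite /x -mulrBl normrM (gtr0_norm e0) ler_pdivrMr// /e mulVf.
have boundV s : `|V s - W s| <= e * (mills 0 + 2 * `|s / r|).
  have d1 := @stein_drift R x (s / r) (s / r + e) e.
  have d2 := @stein_drift R x (s / r) (s / r - e) e.
  rewrite addrAC subrr add0r (gtr0_norm e0) lexx in d1.
  rewrite addrAC subrr add0r normrN (gtr0_norm e0) lexx in d2.
  have := lerD (d1 isT) (d2 isT); rewrite -/(W s) => d.
  rewrite (_ : V s - W s = (((s / r + e) * stein x (s / r + e) - W s) +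
    ((s / r - e) * stein x (s / r - e) - W s)) / 2); last by rewrite /V; field.
  rewrite normrM normfV (@ger0_norm _ 2)// ler_pdivrMr//.
  by rewrite (le_trans (ler_normD _ _))// (le_trans d)//; lra.
apply: (le_trans (ler_norm_walk _ _)).
apply: (@le_trans _ _ (walk n (fun s => (2 * e * mills 0) + ((4 * e * e) * `|s| + 4 * N s)))).
  apply: le_walk => s; rewrite (le_trans (ler_normD _ _))//.
  rewrite (le_trans (lerD (boundU s) (boundV s)))// normrM (gtr0_norm e0).
  by rewrite le_eqVlt; apply/orP; left; apply/eqP; rewrite -/e; ring.
rewrite walkD walk_cst walkD !walkZ.
have wn : walk n (fun s : R => `|s|) <= r.
  by rewrite (le_trans (walk_norm R n))// ler_sqrt ?ler_nat ?ltr0n.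
have nr := walk_near n y; rewrite -/(N _) -/r -/e in nr.
have : 4 * e * e * walk n (fun s : R => `|s|) <= 4 * e * e * r.
  by rewrite ler_wpM2l// !mulr_ge0// ltW.
rewrite -[_ * e * r]mulrA /e mulVf// mulr1 -/e => h.
rewrite (le_trans (lerD (lexx _) (lerD h (ler_wpM2l _ nr))))//.
by rewrite le_eqVlt; apply/orP; left; apply/eqP; rewrite /be_const; ring.
Qed.

(** * The mean fill ratio *)

Definition psi (R : realType) (x : R) : R := 1 - (1 + x) * expR (- x).

Lemma is_derive_psi (R : realType) (x : R) : is_derive x 1 (@psi R) (x * expR (- x)).
Proof.
have E : @psi R = fun x => 1 - (1 + x) * expR (- x) by [].
rewrite [X in is_derive _ _ X _]E; apply: is_derive_eq.
by rewrite /GRing.scale/=; ring.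
Qed.

Lemma psi_mean (R : realType) (x y : R) : x <= y ->
  exists2 c, x <= c <= y & psi y - psi x = c * expR (- c) * (y - x).
Proof. by move=> xy; apply: mean_value => // t; exact: is_derive_psi. Qed.

Lemma psi_le (R : realType) (x y : R) : 0 <= x -> x <= y -> psi x <= psi y.
Proof.
move=> x0 xy; have [c /andP[xc _] E] := psi_mean xy.
by rewrite -subr_ge0 E !mulr_ge0 ?expR_ge0 ?subr_ge0// (le_trans x0).
Qed.

Lemma psi_ge0 (R : realType) (x : R) : 0 <= x -> 0 <= psi x.
Proof. by move=> /(psi_le (lexx 0)); rewrite {1}/psi addr0 oppr0 expR0 mulr1 subrr. Qed.

(** For [t > 0] use [1 + x^2 / 2 <= expR x]; for [t <= 0] use [1 - x <= expR (- x)], which gives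
    [psi x <= x^2 <= x]. *)
Lemma psi_expR_dist (R : realType) (t : R) :
  `|psi (expR t) - (0 < t)%R%:R| <= 4 * expR (- `|t|).
Proof.
have x0 := expR_gt0 t; set x := expR t in x0 *.
have [t0|t0] := ltP 0 t.
  rewrite (gtr0_norm t0) expRN -/x /psi addrAC subrr add0r normrN.
  rewrite ger0_norm ?mulr_ge0 ?expR_ge0 ?addr_ge0 ?(ltW x0)//.
  have h := @expR_ge1Dxn R x 1 (ltW x0).
  have := expR_gt0 x => ex0.
  rewrite expRN ler_pdivrMr// mulrAC ler_pdivlMr//.
  move: h; rewrite (_ : 2`!%:R = 2 :> R)// => h.
  have := sqr_ge0 (x - 1); rewrite sqrrB1; lra.
rewrite /= subr0 (ler0_norm t0) opprK -/x.
rewrite ger0_norm; last by rewrite psi_ge0// ltW.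
have x1 : x <= 1 by rewrite /x expR_le1.
have : (1 + x) * (1 - x) <= (1 + x) * expR (- x).
  by rewrite ler_pM2l ?expR_ge1Dx//; lra.
rewrite /psi; have : x * x <= x by rewrite ler_piMr// ltW.
lra.
Qed.

Definition fill (R : realType) (ell h L : R) (k : nat) : R :=
  walk k (fun s => psi (expR (L - ell * k%:R + h * s))).

Definition fill_const (R : realType) (h : R) : R :=
  be_const R + 4 * (2 / (1 - expR (- h))).

Lemma fill_const_gt0 (R : realType) (h : R) : 0 < h -> 0 < fill_const h.
Proof.
move=> h0; rewrite addr_gt0 ?be_const_gt0// mulr_gt0// divr_gt0//.
by rewrite subr_gt0 expR_lt1 oppr_lt0.
Qed.

(** The exponent is [h * (s - y)], so [psi] of its exponential is a smoothed indicator of [s > y].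
    Sharpening it costs a term bounded by [walk_conc]; the indicator is then handled by
    Berry-Esseen. *)
Lemma fill_approx (R : realType) (ell h L : R) k : 0 < h ->
  `|fill ell h L k - Phi ((L - ell * k%:R) / h / Num.sqrt k.+1%:R)| <=
  fill_const h / Num.sqrt k.+1%:R.
Proof.
move=> h0; set y := (ell * k%:R - L) / h; set r := Num.sqrt _.
have yE s : L - ell * k%:R + h * s = h * (s - y).
  by rewrite /y; field; rewrite gt_eqF.
have -> : (L - ell * k%:R) / h / r = - (y / r) by rewrite /y; ring.
rewrite PhiN.
have be := walk_berry_esseen k y; rewrite -/r in be.
have d : `|fill ell h L k - (1 - walk k (fun s => (s <= y)%R%:R))| <=
    4 * (2 / (1 - expR (- h)) / r).
  apply: le_trans (_ : 4 * walk k (fun s => expR (- (h * `|s - y|))) <= _); last first.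
    by rewrite ler_pM2l// walk_conc.
  rewrite (_ : 1 - _ = walk k (fun s => 1 - (s <= y)%R%:R)); last first.
    by rewrite walkB walk_cst.
  rewrite -walkZ -walkB.
  rewrite (le_trans (ler_norm_walk _ _))//; apply: le_walk => s.
  have -> : 1 - (s <= y)%R%:R = (0 < h * (s - y))%R%:R :> R.
    by rewrite pmulr_rgt0// subr_gt0 ltNge; case: (s <= y); rewrite /= ?subrr ?subr0.
  rewrite yE; apply: le_trans (psi_expR_dist _) _.
  by rewrite normrM (gtr0_norm h0).
rewrite (_ : _ - _ = (fill ell h L k - (1 - walk k (fun s => (s <= y)%R%:R))) -
  (walk k (fun s => (s <= y)%R%:R) - Phi (y / r))); last by ring.
rewrite (le_trans (ler_normB _ _))// (le_trans (lerD d be))//.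
by rewrite /fill_const; lra.
Qed.

(** * Decrease of the mean fill ratio from one level to the next *)

Lemma fill_gapE (R : realType) (ell h L : R) k :
  fill ell h L k - fill ell h L k.+1 =
  walk k (fun s => psi (expR (L - ell * k%:R + h * s)) -
    (psi (expR (L - ell * k%:R + h * s) * expR (h - ell)) +
     psi (expR (L - ell * k%:R + h * s) * expR (- h - ell))) / 2).
Proof.
rewrite /fill [walk k.+1 _]/= -walkB; apply: eq_walk => s /=.
rewrite -!expRD -(natr1 k).
rewrite (_ : L - ell * (k%:R + 1) + h * (s + 1) = L - ell * k%:R + h * s + (h - ell)); last by ring.
by rewrite (_ : L - ell * (k%:R + 1) + h * (s - 1) = L - ell * k%:R + h * s + (- h - ell)); last by ring.
Qed.

(** A lower bound from the mean value theorem for [psi], whose derivative is [c * expR (- c)]. Only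
    the lighter child, of factor [expR (- h - ell)], is used, whence the division by 2. *)
Definition gap_const (R : realType) (ell h D : R) : R :=
  expR (- D) * expR (- h - ell) * expR (- expR D) *
  (expR (- D) * (1 - expR (- h - ell))) / 2.

Lemma gap_const_gt0 (R : realType) (ell h D : R) : 0 <= h -> h < ell ->
  0 < gap_const ell h D.
Proof.
move=> h0 hl; rewrite divr_gt0// !mulr_gt0 ?expR_gt0// subr_gt0 expR_lt1.
lra.
Qed.

Lemma psi_gap (R : realType) (ell h x : R) : 0 <= h -> h < ell -> 0 < x ->
  0 <= psi x - (psi (x * expR (h - ell)) + psi (x * expR (- h - ell))) / 2.
Proof.
move=> h0 hl x0.
have mono e : e <= 0 -> psi (x * expR e) <= psi x.
  move=> e0; apply: psi_le; first by rewrite mulr_ge0 ?expR_ge0// ltW.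
  by rewrite ler_piMr ?expR_le1// ltW.
have m1 : psi (x * expR (h - ell)) <= psi x by apply: mono; lra.
have m2 : psi (x * expR (- h - ell)) <= psi x by apply: mono; lra.
lra.
Qed.

Lemma psi_gap_const (R : realType) (ell h D x : R) : 0 <= h -> h < ell ->
  expR (- D) <= x <= expR D ->
  gap_const ell h D <=
    psi x - (psi (x * expR (h - ell)) + psi (x * expR (- h - ell))) / 2.
Proof.
move=> h0 hl /andP[x1 xD]; have x0 : 0 < x by apply: lt_le_trans x1; exact: expR_gt0.
set b := expR (- h - ell); have b0 : 0 < b by exact: expR_gt0.
have b1 : b < 1 by rewrite expR_lt1; lra.
have h1 : psi (x * expR (h - ell)) <= psi x.
  apply: psi_le; first by rewrite mulr_ge0 ?expR_ge0// ltW.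
  by rewrite ler_piMr ?(ltW x0)// expR_le1; lra.
have bx : x * b <= x by rewrite ler_piMr// ltW.
have [c /andP[bc cx] E] := psi_mean bx.
have : expR (- D) * b * expR (- expR D) * (expR (- D) * (1 - b)) <= psi x - psi (x * b).
  rewrite E ler_pM ?mulr_ge0 ?expR_ge0 ?subr_ge0 ?(ltW b0) ?(ltW b1)//; last first.
    by rewrite (_ : x - x * b = x * (1 - b)) ?ler_wpM2r ?subr_ge0 ?(ltW b1)//; ring.
  rewrite ler_pM ?mulr_ge0 ?expR_ge0 ?(ltW b0)//.
    by apply: le_trans bc; rewrite ler_wpM2r// ltW.
  by rewrite ler_expR lerN2 (le_trans cx).
rewrite /gap_const -/b; lra.
Qed.

Lemma fill_gap (R : realType) (ell h B : R) : 0 < h -> h < ell ->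
  exists2 K : R, 0 < K & exists r0 : R, forall (L : R) k,
    r0 <= Num.sqrt k.+1%:R ->
    `|L - ell * k%:R| <= h * B * Num.sqrt k.+1%:R ->
    K / Num.sqrt k.+1%:R <= fill ell h L k - fill ell h L k.+1.
Proof.
move=> h0 hl.
have gB := gauss_gt0 (`|B| + 1).
(* The window from [y] to [y + W] is wide enough for its normal mass to exceed the two Berry-Esseen
   errors by [1 / r]; on it the argument of [psi] lies between 1 and [expR (h * W)]. *)
pose W : R := (2 * be_const R + 1) / gauss (`|B| + 1).
have W0 : 0 < W by rewrite divr_gt0//; have := be_const_gt0 R; lra.
exists (gap_const ell h (h * W)); first by rewrite gap_const_gt0// ltW.
exists W => L k; have := sqrtn_gt0 R k; set r := Num.sqrt _ => r0 Wr LB.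
set K := gap_const _ _ _; have K0 : 0 < K by rewrite gap_const_gt0// ltW.
set y := (ell * k%:R - L) / h.
have yE s : L - ell * k%:R + h * s = h * (s - y).
  by rewrite /y; field; rewrite gt_eqF.
have yB : `|y / r| <= `|B|.
  rewrite normrM normfV (gtr0_norm r0) ler_pdivrMr// /y normrM normfV (gtr0_norm h0).
  rewrite ler_pdivrMr// distrC (le_trans LB)// -mulrA mulrC ler_pM2r//.
  by rewrite ler_pM2r// ler_norm.
have yW : y / r <= (y + W) / r by rewrite ler_pM2r ?invr_gt0// lerDl ltW.
have [c /andP[yc cy] E] := Phi_mean yW.
have Wr1 : W / r <= 1 by rewrite ler_pdivrMr// mul1r.
have cB : `|c| <= `|B| + 1.
  move: yB cy; rewrite mulrDl !ler_norml => /andP[y1 y2] cy.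
  by apply/andP; split; lra.
have P1 : 1 / r <= walk k (fun s => (s <= y + W)%R%:R) - walk k (fun s => (s <= y)%R%:R).
  have b1 := walk_berry_esseen k y; have b2 := walk_berry_esseen k (y + W).
  rewrite -/r in b1 b2; move: b1 b2; rewrite !ler_norml => /andP[b11 b12] /andP[b21 b22].
  suff : 2 * (be_const R / r) + 1 / r <= Phi ((y + W) / r) - Phi (y / r) by lra.
  rewrite E (_ : (y + W) / r - y / r = W / r); last by ring.
  have : gauss (`|B| + 1) * (W / r) <= gauss c * (W / r).
    rewrite ler_wpM2r ?(ltW (divr_gt0 W0 r0))//; apply: gauss_le.
    by rewrite (le_trans cB)// ler_norm.
  rewrite (_ : _ * (W / r) = (2 * be_const R + 1) / r); first lra.
  by rewrite /W; field; rewrite !gt_eqF.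
rewrite fill_gapE (_ : K / r = K * (1 / r)); last by rewrite mul1r.
apply: (le_trans (ler_wpM2l (ltW K0) P1)).
rewrite -walkB -walkZ; apply: le_walk => s.
have hh : 0 <= h by exact: ltW.
have pg : 0 <= psi (expR (L - ell * k%:R + h * s)) -
    (psi (expR (L - ell * k%:R + h * s) * expR (h - ell)) +
     psi (expR (L - ell * k%:R + h * s) * expR (- h - ell))) / 2.
  by apply: psi_gap => //; exact: expR_gt0.
have [sy|ys] := leP s y.
  have -> : s <= y + W by rewrite (le_trans sy)// lerDl ltW.
  by rewrite subrr mulr0.
have [syW|_] := leP s (y + W); last by rewrite subrr mulr0.
rewrite subr0 mulr1; apply: psi_gap_const => //.
have hys : 0 < h * (s - y) by rewrite mulr_gt0// subr_gt0.
have hW : 0 < h * W by rewrite mulr_gt0.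
rewrite !ler_expR yE (le_trans _ (ltW hys)) ?oppr_le0 ?(ltW hW)//=.
by rewrite ler_pM2l//; lra.
Qed.

(** The analytic input to [fill_select], with [rho] defined by [ell * rho^2 = ln lambda]. The margin
    3 leaves room for rounding to integers and for two further levels; the lower bound on [c] later
    makes [2 ^ K] large. *)
Lemma fill_location (R : realType) (ell h alpha z : R) :
  0 <= h -> h < ell -> 0 < alpha < 1 -> Phi z = alpha ->
  exists M rho0 : R, [/\ 0 < M, 2 <= rho0 & forall rho : R, rho0 <= rho ->
    let c := rho ^+ 2 - h * z / ell * rho in
    let L := ell * rho ^+ 2 in
    rho ^+ 2 / 2 + (M + 3) <= c /\
    forall k : nat, `|k%:R - c| <= M + 3 ->
      [/\ c + M <= k%:R -> fill ell h L k < alpha,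
          k%:R <= c - M -> alpha + (rho ^+ 2)^-1 <= fill ell h L k &
          2 * (rho ^+ 2)^-1 <= fill ell h L k - fill ell h L k.+1]].
Proof.
move=> h0 hl /andP[al0 al1] za.
have l0 : 0 < ell by exact: le_lt_trans hl.
pose g := h * z / ell.
have cbound (M rho : R) : 0 < M -> 4 * `|g| + 4 * (M + 3) <= rho ->
    rho ^+ 2 / 2 + (M + 3) <= rho ^+ 2 - g * rho.
  move=> M0 r0; have g0 := normr_ge0 g; have rho1 : 1 <= rho by lra.
  have : g * rho <= `|g| * rho by rewrite ler_wpM2r ?ler_norm//; lra.
  have : (4 * `|g| + 4 * (M + 3)) * rho <= rho * rho by rewrite ler_wpM2r//; lra.
  have : 4 * (M + 3) * 1 <= 4 * (M + 3) * rho by rewrite ler_wpM2l//; lra.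
  have : 0 <= `|g| * rho by rewrite mulr_ge0//; lra.
  rewrite expr2; lra.
(* The case [h = 0], that is [p = 1/2], is separate: all words of a level are equally likely, and
   the mean falls from near 1 to near 0 within boundedly many levels. *)
have [hp|hn] := ltP 0 h; last first.
  have {hn}h00 : h = 0 by apply/le_anti; rewrite hn.
  have gg : g = 0 by rewrite /g h00 !mul0r.
  pose eta := Num.min alpha (1 - alpha) / 2.
  have eta0 : 0 < eta by rewrite divr_gt0// lt_min al0 subr_gt0.
  have [eta1 eta2] : eta < alpha /\ 2 * eta <= 1 - alpha.
    have e2 : 2 * eta = Num.min alpha (1 - alpha) by rewrite /eta; field.
    have : Num.min alpha (1 - alpha) <= alpha by rewrite ge_min lexx.
    have : Num.min alpha (1 - alpha) <= 1 - alpha by rewrite ge_min lexx orbT.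
    by rewrite -e2 => ? ?; split; lra.
  clearbody eta.
  (* With this [M], [4 * expR (- (ell * M)) <= eta]. One [eta] absorbs this tail of [psi], the
     second one in [2 * eta <= 1 - alpha] absorbs [(rho ^+ 2)^-1]. *)
  pose M := 4 / eta / ell.
  have M0 : 0 < M by rewrite !divr_gt0.
  pose K := gap_const ell h (ell * (M + 3)).
  have K0 : 0 < K by exact: gap_const_gt0.
  have fE L k : fill ell h L k = psi (expR (L - ell * k%:R)).
    by rewrite -[RHS](walk_cst k); apply: eq_walk => s; rewrite h00 mul0r addr0.
  have e4 t : ell * M <= t -> 4 * expR (- t) <= eta.
    move=> Mt; have t0 : 0 < t by apply: lt_le_trans Mt; rewrite mulr_gt0.
    rewrite expRN ler_pdivrMr ?expR_gt0// -ler_pdivrMl//.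
    apply: le_trans (expR_ge1Dx t).
    by move: Mt; rewrite /M (mulrC ell) divfK ?gt_eqF// [eta^-1 * _]mulrC; lra.
  exists M, (4 * `|g| + 4 * (M + 3) + 1 / eta + 2 / K); split=> //.
    by rewrite gg normr0; have := divr_gt0 ltr01 eta0; have := @divr_gt0 _ 2 K _ K0; lra.
  move=> rho rhoM c L; have i1 := divr_gt0 ltr01 eta0; have i2 : 0 < 2 / K by rewrite divr_gt0.
  have g0 := normr_ge0 g.
  have rr : rho <= rho ^+ 2 by rewrite expr2 ler_peMl//; lra.
  have rho0 : 0 < rho ^+ 2 by apply: lt_le_trans rr; lra.
  have d1 : (rho ^+ 2)^-1 <= eta.
    by rewrite -[leRHS]invrK lef_pV2 ?posrE ?invr_gt0// (le_trans _ rr)//; lra.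
  have d2 : 2 * (rho ^+ 2)^-1 <= K.
    rewrite ler_pdivrMr// mulrC -ler_pdivrMr// (le_trans _ rr)//; lra.
  split; first by apply: cbound => //; lra.
  have LE k : L - ell * k%:R = - (ell * (k%:R - c)).
    by rewrite /L /c -/g gg mul0r subr0; ring.
  move=> k kc; split.
  - move=> ck; rewrite fE LE.
    have uM : ell * M <= ell * (k%:R - c) by rewrite ler_pM2l//; lra.
    have u0 : 0 < ell * (k%:R - c) by apply: lt_le_trans uM; rewrite mulr_gt0.
    have := psi_expR_dist (- (ell * (k%:R - c))).
    rewrite normrN (gtr0_norm u0) oppr_gt0 ltNge (ltW u0) /= subr0 => h1.
    by apply: le_lt_trans eta1; apply: le_trans (e4 _ uM); apply: le_trans h1; exact: ler_norm.
  - move=> ck; rewrite fE LE -mulrN.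
    have uM : ell * M <= ell * - (k%:R - c) by rewrite ler_pM2l//; lra.
    have u0 : 0 < ell * - (k%:R - c) by apply: lt_le_trans uM; rewrite mulr_gt0.
    have := psi_expR_dist (ell * - (k%:R - c)).
    rewrite (gtr0_norm u0) u0 /= => h1.
    have := le_trans h1 (e4 _ uM); rewrite ler_norml => /andP[h2 _].
    by move: d1 eta2 h2 => /=; lra.
  - apply: le_trans d2 _; rewrite fill_gapE -[K](walk_cst k); apply: le_walk => s.
    apply: psi_gap_const => //; rewrite LE h00 mul0r addr0.
    rewrite !ler_expR lerN2 lerNl -!mulrN !ler_pM2l//.
    by move: kc; rewrite ler_norml => /andP[k1 k2]; apply/andP; split; lra.
pose C := fill_const h; have C0 : 0 < C by exact: fill_const_gt0.
(* [E0] bounds [z * (rho - r)]. A normal increment over length [D / r] near [z] is at least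
   [(C + 1) / r]: the approximation error plus a spare [1 / r >= (rho ^+ 2)^-1]. [M] is chosen so
   that [ell * M / h = D + E0]. *)
pose E0 := `|z| * (`|g| + 1).
have g0 := normr_ge0 g.
have E00 : 0 <= E0 by rewrite mulr_ge0// addr_ge0.
have gz0 := gauss_gt0 (`|z| + 1).
pose D := (C + 1) / gauss (`|z| + 1).
have D0 : 0 < D by rewrite divr_gt0// addr_gt0.
pose M := h * (D + E0) / ell.
have M0 : 0 < M by rewrite divr_gt0// mulr_gt0// ltr_pwDl.
have [K K0 [r0 gapP]] := @fill_gap R ell h (`|z| + 1) hp hl.
(* [N <= r] keeps the argument of [Phi] within 1 of [z] for all levels within [M + 3] of the
   centre. *)
pose N := E0 + ell * (M + 3) / h.
have N0 : 0 < N by rewrite ltr_wpDl// divr_gt0// mulr_gt0//; lra.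
exists M, (4 * `|g| + 4 * (M + 3) + 2 * D + 2 * N + 2 * `|r0| + 4 / K + 2).
have K40 : 0 < 4 / K by rewrite divr_gt0.
have r00 := normr_ge0 r0.
split=> //; first lra.
move=> rho rhoM c L.
have rho1 : 1 <= rho by lra.
have rho0 : 0 < rho by lra.
split; first by apply: cbound => //; lra.
move=> k; set u := k%:R - c => uM.
have := sqrtn_gt0 R k; set r := Num.sqrt _ => rp.
have rn0 : r != 0 by rewrite gt_eqF.
have r2 : r * r = k.+1%:R by exact: sqrtn_sqr.
have kE : k%:R = rho * rho - g * rho + u by rewrite /u /c -/g expr2; ring.
(* [rho] and [r] agree up to [O(1)], uniformly in [M]: this is what allows [M] to be
   chosen after the constant [E0]. *)
have rrho : `|rho - r| <= `|g| + 1.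
  have pos : 0 < rho + r by rewrite addr_gt0.
  rewrite -(ler_pM2r pos) -{1}(gtr0_norm pos) -normrM.
  rewrite (_ : (rho - r) * (rho + r) = g * rho - (u + 1)); last first.
    by rewrite (_ : _ * _ = rho * rho - r * r); [rewrite r2 -natr1 kE; ring|ring].
  rewrite (le_trans (ler_normB _ _))// normrM (gtr0_norm rho0).
  have := ler_normD u 1; rewrite normr1 => u1.
  have : 0 <= `|g| * r by rewrite mulr_ge0// ltW.
  lra.
have rlow : rho / 2 <= r by move: rrho; rewrite ler_norml; lra.
have rup : r <= 2 * rho by move: rrho; rewrite ler_norml; lra.
have rD : D <= r by lra.
(* The centre [c] is designed for this: the terms of order [rho^2] cancel and those of order [rho]
   leave exactly [z]. *)
have argE : (L - ell * k%:R) / h / r = z + (z * (rho - r) - ell * u / h) / r.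
  rewrite /L kE expr2 /g; field; rewrite rn0 /=.
  by rewrite !gt_eqF.
have zE : `|z * (rho - r)| <= E0 by rewrite normrM ler_wpM2l.
have DM : ell * M / h = D + E0 by rewrite /M; field; rewrite !gt_eqF.
have Dr1 : D / r <= 1 by rewrite ler_pdivrMr// mul1r.
have Dr0 : 0 < D / r by rewrite divr_gt0.
have gD c1 : `|c1| <= `|z| + 1 -> (C + 1) / r <= gauss c1 * (D / r).
  move=> c1z; have : gauss (`|z| + 1) * (D / r) <= gauss c1 * (D / r).
    rewrite ler_wpM2r ?(ltW Dr0)//; apply: gauss_le.
    by rewrite (le_trans c1z)// ler_norm.
  by apply: le_trans; rewrite /D mulrA [_ * ((C + 1) / _)]mulrC divfK ?gt_eqF.
have znorm := ler_norm z; have znormN : - z <= `|z| by rewrite -normrN ler_norm.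
have fa := fill_approx ell L k hp; rewrite -/r argE -/C in fa.
have rinv : (rho ^+ 2)^-1 <= r^-1.
  rewrite lef_pV2 ?posrE ?exprn_gt0// (le_trans rup)// expr2 ler_pM2r//; lra.
move: fa; rewrite ler_norml => /andP[fa1 fa2].
split.
- move=> ck.
  have : Phi (z + (z * (rho - r) - ell * u / h) / r) <= Phi (z - D / r).
    apply: Phi_le; rewrite lerD2l -(mulNr D) ler_pM2r ?invr_gt0//.
    have : ell * M / h <= ell * u / h by rewrite ler_pM2r ?invr_gt0// ler_pM2l// /u; lra.
    by move: zE; rewrite DM ler_norml; lra.
  have zD : z - D / r <= z by lra.
  have [c1 /andP[c11 c12]] := Phi_mean zD; rewrite za (_ : z - (z - D / r) = D / r) => [E|]; last by ring.
  have : (C + 1) / r <= gauss c1 * (D / r) by apply: gD; rewrite ler_norml; lra.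
  have r10 : 0 < 1 / r by rewrite divr_gt0.
  by rewrite -E mulrDl; lra.
- move=> ck.
  have : Phi (z + D / r) <= Phi (z + (z * (rho - r) - ell * u / h) / r).
    apply: Phi_le; rewrite lerD2l ler_pM2r ?invr_gt0//.
    have : ell * u / h <= ell * (- M) / h by rewrite ler_pM2r ?invr_gt0// ler_pM2l// /u; lra.
    by move: zE; rewrite mulrN mulNr DM ler_norml; lra.
  have zD : z <= z + D / r by lra.
  have [c1 /andP[c11 c12]] := Phi_mean zD; rewrite za (_ : z + D / r - z = D / r) => [E|]; last by ring.
  have : (C + 1) / r <= gauss c1 * (D / r) by apply: gD; rewrite ler_norml; lra.
  by rewrite -E mulrDl; lra.
- have argB : `|L - ell * k%:R| <= h * (`|z| + 1) * r.
    have eqB : (`|L - ell * k%:R| <= h * (`|z| + 1) * r) =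
        (`|(L - ell * k%:R) / h / r| <= `|z| + 1).
      rewrite !normrM !normfV (gtr0_norm hp) (gtr0_norm rp) !ler_pdivrMr//.
      by congr (_ <= _); ring.
    rewrite eqB argE.
    rewrite (le_trans (ler_normD _ _))// lerD2l normrM normfV (gtr0_norm rp).
    rewrite ler_pdivrMr// mul1r (le_trans (ler_normB _ _))//.
    rewrite (le_trans (lerD zE (lexx _)))// !normrM normfV (gtr0_norm hp) (gtr0_norm l0).
    have : ell * `|u| / h <= ell * (M + 3) / h by rewrite ler_pM2r ?invr_gt0// ler_pM2l.
    by rewrite /N in N0 rhoM *; lra.
  have r0r : r0 <= r by have := ler_norm r0; lra.
  (* The gap [K / r] is of order [1 / rho], hence exceeds [2 / rho^2] once [K * rho >= 4]. *)
  apply: le_trans (gapP L k r0r argB).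
  rewrite ler_pdivlMr// mulrAC ler_pdivrMr ?exprn_gt0//.
  have : 4 <= K * rho by rewrite mulrC -ler_pdivrMr//; lra.
  move=> K4; rewrite -/r; apply: (@le_trans _ _ (4 * rho)); first lra.
  by rewrite expr2 mulrA ler_pM2r.
Qed.

(** * Poissonized occupancy counts *)

Lemma sum_tupleS (R : nmodType) (W : finType) n (F : n.+1.-tuple W -> R) :
  \sum_t F t = \sum_x \sum_(t : n.-tuple W) F [tuple of x :: t].
Proof.
rewrite pair_big /= (reindex (fun u : W * n.-tuple W => [tuple of u.1 :: u.2])) //=.
exists (fun t : n.+1.-tuple W => (thead t, [tuple of behead t])) => [[x t] _|t _] /=.
  by congr pair; apply: val_inj.
by rewrite [RHS]tuple_eta; apply: val_inj.
Qed.

Lemma sum_tuple0 (R : nmodType) (W : finType) (F : 0.-tuple W -> R) :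
  \sum_t F t = F [tuple].
Proof.
rewrite (bigD1 [tuple])//= big1 ?addr0// => t /eqP[].
exact: tuple0.
Qed.

(** A mean over independent draws; [G] is defined on sequences of any length so that the recursion
    on [n] can peel off the first draw. *)
Definition iid (R : realType) (W : finType) (w : W -> R) n (G : seq W -> R) : R :=
  \sum_(t : n.-tuple W) (\prod_(x <- t) w x) * G t.

Lemma iid0 (R : realType) (W : finType) (w : W -> R) G : iid w 0 G = G [::].
Proof. by rewrite /iid sum_tuple0 big_nil mul1r. Qed.

Lemma iidS (R : realType) (W : finType) (w : W -> R) n G :
  iid w n.+1 G = \sum_x w x * iid w n (fun s => G (x :: s)).
Proof.
rewrite /iid sum_tupleS; apply: eq_bigr => x _; rewrite big_distrr.
by apply: eq_bigr => t _ /=; rewrite big_cons mulrA.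
Qed.

Lemma eq_iid (R : realType) (W : finType) (w : W -> R) n F G :
  F =1 G -> iid w n F = iid w n G.
Proof. by move=> FG; apply: eq_bigr => t _; rewrite FG. Qed.

Lemma iidD (R : realType) (W : finType) (w : W -> R) n F G :
  iid w n (fun s => F s + G s) = iid w n F + iid w n G.
Proof. by rewrite /iid -big_split; apply: eq_bigr => t _; rewrite mulrDr. Qed.

Lemma iidZ (R : realType) (W : finType) (w : W -> R) n a F :
  iid w n (fun s => a * F s) = a * iid w n F.
Proof. by rewrite /iid big_distrr; apply: eq_bigr => t _; rewrite mulrCA. Qed.

Lemma iid_sum (R : realType) (W I : finType) (w : W -> R) n (F : I -> seq W -> R) :
  iid w n (fun s => \sum_i F i s) = \sum_i iid w n (F i).
Proof.
by rewrite /iid exchange_big; apply: eq_bigr => t _; rewrite big_distrr.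
Qed.

Lemma le_iid (R : realType) (W : finType) (w : W -> R) n F G :
  (forall x, 0 <= w x) -> (forall s, F s <= G s) -> iid w n F <= iid w n G.
Proof.
by move=> w0 FG; apply: ler_sum => t _; rewrite ler_wpM2l// prodr_ge0.
Qed.

Lemma iid_cst (R : realType) (W : finType) (w : W -> R) n (a : R) :
  \sum_x w x = 1 -> iid w n (fun=> a) = a.
Proof.
move=> w1; elim: n => [|n IH]; first by rewrite iid0.
by rewrite iidS -[RHS]mul1r -w1 big_distrl /=; apply: eq_bigr => x _; rewrite IH.
Qed.

(* The [j]-th derivative of [c ^+ n] in [c]; for [n < j] it is 0. *)
Definition ffpow (R : realType) (c : R) (j n : nat) : R := (n ^_ j)%:R * c ^+ (n - j).

Lemma ffpow0 (R : realType) (c : R) n : ffpow c 0 n = c ^+ n.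
Proof. by rewrite /ffpow ffactn0 mul1r subn0. Qed.

Lemma ffpow0n (R : realType) (c : R) j : ffpow c j.+1 0 = 0.
Proof. by rewrite /ffpow ffact0n mul0r. Qed.

(** Leibniz' rule for the derivative of order [j.+1] of [c * c ^+ n]. *)
Lemma ffpowS (R : realType) (c : R) j n :
  ffpow c j.+1 n.+1 = c * ffpow c j.+1 n + j.+1%:R * ffpow c j n.
Proof.
rewrite /ffpow ffactSS subSS ffactnSr.
have [nj|jn] := ltnP n j; first by rewrite ffact_small// muln0 mul0n !mul0r !mulr0 add0r.
have [nj|nj] := eqVneq n j.
  by rewrite nj subnn muln0 mul0r mulr0 add0r natrM !mulr1.
have {nj}jn' : (j < n)%N by rewrite ltn_neqAle eq_sym nj.
rewrite -(subnSK jn') exprS; set e := c ^+ _.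
have -> : n.+1 = ((n - j.+1).+1 + j.+1)%N by rewrite subnSK// addnS subnK.
by rewrite !natrM natrD; ring.
Qed.

Lemma sum_mul_split1 (R : realType) (W : finType) (w H : W -> R) (r : W) (h1 h2 : R) :
  \sum_x w x = 1 -> H r = h1 -> (forall x, x != r -> H x = h2) ->
  \sum_x w x * H x = w r * h1 + (1 - w r) * h2.
Proof.
move=> w1 H1 H2; rewrite (bigD1 r)//= H1; congr (_ + _).
have -> : 1 - w r = \sum_(x | x != r) w x.
  by rewrite -w1 (bigD1 r)//= addrAC subrr add0r.
rewrite big_distrl /=.
by apply: eq_bigr => x /H2 ->.
Qed.

Lemma sum_mul_split2 (R : realType) (W : finType) (w H : W -> R) (r r' : W) (h1 h2 h3 : R) :
  \sum_x w x = 1 -> r != r' -> H r = h1 -> H r' = h2 ->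
  (forall x, x != r -> x != r' -> H x = h3) ->
  \sum_x w x * H x = w r * h1 + w r' * h2 + (1 - w r - w r') * h3.
Proof.
move=> w1 rr H1 H2 H3; rewrite (bigD1 r)//= H1 (bigD1 r')//=; last by rewrite eq_sym.
rewrite H2 -addrA; congr (_ + (_ + _)).
have -> : 1 - w r - w r' = \sum_(x | (x != r) && (x != r')) w x.
  rewrite -w1 (bigD1 r)//= (bigD1 r')//=; last by rewrite eq_sym.
  by ring.
by rewrite big_distrl /=; apply: eq_bigr => x /andP[xr xr']; rewrite H3.
Qed.

Definition count_lt (W : eqType) (i : nat) (r : W) (s : seq W) : bool :=
  (count_mem r s < i)%N.

Lemma count_lt_cons_eq (W : eqType) i (r : W) s : count_lt i.+1 r (r :: s) = count_lt i r s.
Proof. by rewrite /count_lt /= eqxx. Qed.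

Lemma count_lt_cons_neq (W : eqType) i (r x : W) s : x != r -> count_lt i r (x :: s) = count_lt i r s.
Proof. by rewrite /count_lt /= => /negbTE ->. Qed.

Lemma count_lt0 (W : eqType) (r : W) s : count_lt 0 r s = false.
Proof. by []. Qed.

(** * Probability of few occurrences of one word or of two words *)

Section Counts.
Context (R : realType) (W : finType) (w : W -> R) (w1 : \sum_x w x = 1).

Let Q1 i r n := iid w n (fun s => (count_lt i r s)%:R).
Let Q2 i j r r' n := iid w n (fun s => (count_lt i r s && count_lt j r' s)%:R).

Let Q10 r n : Q1 0 r n = 0.
Proof. by rewrite -(iid_cst n 0 w1); apply: eq_iid. Qed.

Let Q20 j r r' n : Q2 0 j r r' n = 0.
Proof. by rewrite -(iid_cst n 0 w1); apply: eq_iid. Qed.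

Let Q2_0 i r r' n : Q2 i 0 r r' n = 0.
Proof. by rewrite -(iid_cst n 0 w1); apply: eq_iid => s; rewrite count_lt0 andbF. Qed.

Let Q1S i r n : Q1 i.+1 r n.+1 = w r * Q1 i r n + (1 - w r) * Q1 i.+1 r n.
Proof.
rewrite {1}/Q1 iidS; apply: sum_mul_split1 => // [|x xr]; apply: eq_iid => s.
  by rewrite count_lt_cons_eq.
by rewrite count_lt_cons_neq.
Qed.

Let Q2S i j r r' n : r != r' -> Q2 i.+1 j.+1 r r' n.+1 =
  w r * Q2 i j.+1 r r' n + w r' * Q2 i.+1 j r r' n +
  (1 - w r - w r') * Q2 i.+1 j.+1 r r' n.
Proof.
move=> rr; rewrite {1}/Q2 iidS; apply: sum_mul_split2 => // [||x xr xr']; apply: eq_iid => s.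
- by rewrite count_lt_cons_eq count_lt_cons_neq.
- by rewrite count_lt_cons_eq count_lt_cons_neq// eq_sym.
- by rewrite !count_lt_cons_neq.
Qed.

(** The terms are no hit and exactly one hit. They are written with [ffpow] so that [pois_sum_ffpow]
    can average them over [n]. *)
Lemma iid_count_lt2 r n : iid w n (fun s => (count_lt 2 r s)%:R) =
  ffpow (1 - w r) 0 n + w r * ffpow (1 - w r) 1 n.
Proof.
have E1 m : Q1 1 r m = ffpow (1 - w r) 0 m.
  rewrite ffpow0; elim: m => [|m IH]; first by rewrite /Q1 iid0.
  by rewrite Q1S Q10 IH mulr0 add0r exprS.
rewrite -/(Q1 2 r n); elim: n => [|n IH].
  by rewrite /Q1 iid0 ffpow0 ffpow0n mulr0 addr0.
by rewrite Q1S IH E1 ffpowS !ffpow0 exprS; ring.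
Qed.

(** Here [c] is the probability of missing both words; the terms stand for no hit, one hit in total,
    and one hit on each word. *)
Lemma iid_count_lt2_pair r r' n : r != r' ->
  iid w n (fun s => (count_lt 2 r s && count_lt 2 r' s)%:R) =
  let c := 1 - w r - w r' in
  ffpow c 0 n + (w r + w r') * ffpow c 1 n + w r * w r' * ffpow c 2 n.
Proof.
move=> rr; set c := 1 - w r - w r'; rewrite /=.
have E11 m : Q2 1 1 r r' m = ffpow c 0 m.
  rewrite ffpow0; elim: m => [|m IH]; first by rewrite /Q2 iid0.
  by rewrite Q2S// Q20 Q2_0 IH !mulr0 !add0r exprS.
have E21 m : Q2 2 1 r r' m = ffpow c 0 m + w r * ffpow c 1 m.
  elim: m => [|m IH]; first by rewrite /Q2 iid0 ffpow0 ffpow0n mulr0 addr0.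
  by rewrite Q2S// E11 Q2_0 IH ffpowS !ffpow0 exprS -/c; ring.
have E12 m : Q2 1 2 r r' m = ffpow c 0 m + w r' * ffpow c 1 m.
  elim: m => [|m IH]; first by rewrite /Q2 iid0 ffpow0 ffpow0n mulr0 addr0.
  by rewrite Q2S// E11 Q20 IH ffpowS !ffpow0 exprS -/c; ring.
rewrite -/(Q2 2 2 r r' n); elim: n => [|n IH].
  by rewrite /Q2 iid0 ffpow0 !ffpow0n !mulr0 !addr0.
by rewrite Q2S// IH E21 E12 !ffpowS !ffpow0 exprS -/c; ring.
Qed.

End Counts.

(** A Poisson expectation as a relation, carrying convergence and value together. *)
Definition pois_sum (R : realType) (lambda : R) (F : nat -> R) (l : R) :=
  series (fun n => poisson_pmf lambda n * F n) @ \oo --> l.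

Lemma pois_sumD (R : realType) (lambda : R) F G (a b : R) :
  pois_sum lambda F a -> pois_sum lambda G b ->
  pois_sum lambda (fun n => F n + G n) (a + b).
Proof.
move=> Fa Gb; rewrite /pois_sum.
rewrite (_ : series _ = series (fun n => poisson_pmf lambda n * F n) +
    series (fun n => poisson_pmf lambda n * G n)); first exact: cvgD.
by apply/funext => n; rewrite fctE /series /= -big_split; apply: eq_bigr => i _; rewrite mulrDr.
Qed.

Lemma pois_sumZ (R : realType) (lambda : R) F (c a : R) :
  pois_sum lambda F a -> pois_sum lambda (fun n => c * F n) (c * a).
Proof.
move=> Fa; rewrite /pois_sum.
rewrite (_ : series _ = (fun n => c * series (fun n => poisson_pmf lambda n * F n) n)).
  by apply: cvgMl_tmp.
by apply/funext => n; rewrite /series /= big_distrr; apply: eq_bigr => i _; rewrite mulrCA.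
Qed.

Lemma pois_sum_big (R : realType) (lambda : R) (I : finType) (F : I -> nat -> R) (l : I -> R) :
  (forall i, pois_sum lambda (F i) (l i)) ->
  pois_sum lambda (fun n => \sum_i F i n) (\sum_i l i).
Proof.
move=> Fl.
elim: (index_enum I) => [|i s IH].
  rewrite big_nil /pois_sum (_ : series _ = fun=> 0); first exact: cvg_cst.
  by apply/funext => n; rewrite /series /= big1// => j _; rewrite big_nil mulr0.
rewrite big_cons (_ : (fun n => _) = (fun n => F i n + \sum_(j <- s) F j n)).
  exact: pois_sumD.
by apply/funext => n; rewrite big_cons.
Qed.

(** The first [j] terms vanish, and the rest is an exponential series at [lambda * c] shifted by
    [j]. *)
Lemma pois_sum_ffpow (R : realType) (lambda c : R) j : 0 < lambda ->
  pois_sum lambda (ffpow c j) (lambda ^+ j * expR (- (lambda * (1 - c)))).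
Proof.
move=> l0; rewrite /pois_sum -(@cvg_shiftn j).
rewrite (_ : (fun n => _) =
    (fun n => (expR (- lambda) * lambda ^+ j) * series (exp_coeff (lambda * c)) n)).
  rewrite (_ : _ * expR _ = (expR (- lambda) * lambda ^+ j) * expR (lambda * c)).
    by apply: cvgMl_tmp; exact: is_cvg_series_exp_coeff.
  rewrite (_ : expR (- (lambda * (1 - c))) = expR (- lambda) * expR (lambda * c)).
    by ring.
  by rewrite -expRD; congr expR; ring.
apply/funext => n; rewrite /series /= (@big_cat_nat _ _ _ j)//=; last exact: leq_addl.
rewrite big_nat big1 ?add0r; last first.
  by move=> i /andP[_ ij]; rewrite /ffpow ffact_small// mul0r mulr0.
rewrite -{1}[j]add0n big_addn addnK big_distrr /=; apply: eq_bigr => i _.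
rewrite /poisson_pmf l0 /ffpow addnK /exp_coeff /=.
have f0 : (i + j)`!%:R != 0 :> R by rewrite pnatr_eq0 -lt0n fact_gt0.
have g0 : i`!%:R != 0 :> R by rewrite pnatr_eq0 -lt0n fact_gt0.
have -> : (i + j)`!%:R = ((i + j) ^_ j)%:R * i`!%:R :> R.
  by rewrite -natrM -{3}[i](addnK j) ffact_fact// leq_addl.
have h0 : ((i + j) ^_ j)%:R != 0 :> R.
  by rewrite pnatr_eq0 -lt0n ffact_gt0 leq_addl.
by rewrite exprD exprMn; field; rewrite g0 h0.
Qed.

(** With Poisson many draws the covariances of distinct words vanish, and each diagonal term
    [g r - g r ^+ 2] is at most 1. *)
Lemma pois_variance (R : realType) (lambda : R) (W : finType) (w : W -> R) :
  0 < lambda -> \sum_x w x = 1 ->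
  exists2 v, v <= #|W|%:R & pois_sum lambda
    (fun n => iid w n (fun s => (\sum_r (count_lt 2 r s)%:R -
       \sum_r (1 + lambda * w r) * expR (- (lambda * w r))) ^+ 2)) v.
Proof.
move=> l0 w1; pose g r := (1 + lambda * w r) * expR (- (lambda * w r)).
pose b (r : W) (s : seq W) : R := (count_lt 2 r s)%:R.
exists (\sum_r \sum_r' (if r == r' then g r - g r * g r else 0)).
  rewrite -sum1_card natr_sum; apply: ler_sum => r _.
  rewrite (bigD1 r)//= eqxx big1 ?addr0; last by move=> r'; rewrite eq_sym => /negbTE ->.
  have := sqr_ge0 (g r - 1); rewrite sqrrB1; have := sqr_ge0 (g r); rewrite !expr2; lra.
pose F r r' n := iid w n (fun s => b r s * b r' s + ((- g r) * b r' s + ((- g r') * b r s + g r * g r'))).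
rewrite (_ : (fun n => _) = (fun n => \sum_r \sum_r' F r r' n)); last first.
  apply/funext => n; under [RHS]eq_bigr do rewrite -iid_sum.
  rewrite -iid_sum; apply: eq_iid => s; rewrite -sumrB expr2 big_distrl.
  apply: eq_bigr => r _; rewrite big_distrr; apply: eq_bigr => r' _ /=.
  by rewrite -/(g r) -/(g r') -/(b r s) -/(b r' s); ring.
have ps1 r : pois_sum lambda (fun n => iid w n (b r)) (g r).
  rewrite (_ : (fun n => _) = (fun n => ffpow (1 - w r) 0 n + w r * ffpow (1 - w r) 1 n)); last first.
    by apply/funext => n; rewrite -iid_count_lt2.
  have -> : g r = lambda ^+ 0 * expR (- (lambda * (1 - (1 - w r)))) +
      w r * (lambda ^+ 1 * expR (- (lambda * (1 - (1 - w r))))).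
    by rewrite /g (_ : 1 - (1 - w r) = w r); ring.
  by apply: pois_sumD; [|apply: pois_sumZ]; exact: pois_sum_ffpow.
have psc (a : R) : pois_sum lambda (fun n => iid w n (fun=> a)) a.
  rewrite (_ : (fun n => _) = (fun n => a * ffpow 1 0 n)); last first.
    by apply/funext => n; rewrite iid_cst// ffpow0 expr1n mulr1.
  have := @pois_sum_ffpow _ lambda 1 0 l0.
  rewrite subrr mulr0 oppr0 expR0 mulr1 expr0 => h.
  by rewrite -[X in pois_sum _ _ X]mulr1; exact: pois_sumZ.
apply: pois_sum_big => r; apply: pois_sum_big => r'.
have ps2 : pois_sum lambda (fun n => iid w n (fun s => b r s * b r' s))
    (if r == r' then g r else g r * g r').
  have [<-|rr] := eqVneq r r'.
    rewrite (_ : (fun n => _) = (fun n => iid w n (b r))); first exact: ps1.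
    by apply/funext => n; apply: eq_iid => s; rewrite /b -natrM mulnb andbb.
  pose c := 1 - w r - w r'.
  rewrite (_ : (fun n => _) = (fun n => ffpow c 0 n +
      ((w r + w r') * ffpow c 1 n + w r * w r' * ffpow c 2 n))); last first.
    apply/funext => n; rewrite addrA -[RHS](iid_count_lt2_pair w1 n rr).
    by apply: eq_iid => s; rewrite /b -natrM mulnb.
  (* Poisson independence: the three terms sum to [1 + lambda * (w r + w r') + lambda^2 * w r * w
     r'] times an exponential, which factors. *)
  have -> : g r * g r' = lambda ^+ 0 * expR (- (lambda * (1 - c))) +
     ((w r + w r') * (lambda ^+ 1 * expR (- (lambda * (1 - c)))) +
      w r * w r' * (lambda ^+ 2 * expR (- (lambda * (1 - c))))).
    rewrite (_ : - (lambda * (1 - c)) = - (lambda * w r) + - (lambda * w r')).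
      by rewrite expRD /g; ring.
    by rewrite /c; ring.
  by apply: pois_sumD; [|apply: pois_sumD; apply: pois_sumZ]; exact: pois_sum_ffpow.
rewrite (_ : F r r' = fun n => iid w n (fun s => b r s * b r' s) + (- g r * iid w n (b r') +
    (- g r' * iid w n (b r) + iid w n (fun=> g r * g r')))); last first.
  by apply/funext => n; rewrite /F iidD iidD iidD !iidZ.
have := pois_sumD ps2 (pois_sumD (@pois_sumZ _ _ _ (- g r) _ (ps1 r'))
  (pois_sumD (@pois_sumZ _ _ _ (- g r') _ (ps1 r)) (psc (g r * g r')))).
congr (pois_sum _ _ _); have [<-|_] := eqVneq r r'; by ring.
Qed.

(** Chebyshev's inequality term by term in the number of draws. Partial sums suffice for
    [event_bound]. *)
Lemma pois_chebyshev (R : realType) (lambda : R) (W : finType) (w : W -> R) (D : R) n :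
  0 < lambda -> (forall x, 0 <= w x) -> \sum_x w x = 1 -> 0 < D ->
  \sum_(0 <= i < n) poisson_pmf lambda i * iid w i (fun s =>
     (D <= `|\sum_r (count_lt 2 r s)%:R -
       \sum_r (1 + lambda * w r) * expR (- (lambda * w r))|)%R%:R)
  <= #|W|%:R / D ^+ 2.
Proof.
move=> l0 w0 w1 D0; have [v vW psv] := pois_variance l0 w1.
set m := \sum_r (1 + _) * _ in psv *.
pose u i := poisson_pmf lambda i * iid w i (fun s => (\sum_r (count_lt 2 r s)%:R - m) ^+ 2).
have u0 i : 0 <= u i.
  rewrite mulr_ge0 ?poisson_pmf_ge0// sumr_ge0// => t _.
  by rewrite mulr_ge0 ?sqr_ge0// prodr_ge0.
have uv : series u n <= v.
  have nd : nondecreasing_seq (series u) by apply: nondecreasing_series => i _ _; exact: u0.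
  have := nondecreasing_cvgn_le nd (cvgP _ psv) n.
  by rewrite (cvg_lim _ psv).
apply: le_trans (_ : series u n / D ^+ 2 <= _); last first.
  by rewrite ler_pM2r ?invr_gt0 ?exprn_gt0// (le_trans uv).
rewrite /series /= big_distrl /=; apply: ler_sum => i _.
rewrite /u -mulrA ler_wpM2l ?poisson_pmf_ge0// mulrC -iidZ.
apply: le_iid => // s; set y := _ - m.
have [Dy|_] := leP D `|y|; last by rewrite mulr_ge0 ?invr_ge0 ?sqr_ge0// exprn_ge0// ltW.
rewrite mulrC ler_pdivlMr ?exprn_gt0// mul1r -[y ^+ 2]real_normK ?num_real//.
by rewrite lerXn2r ?nnegrE// ltW.
Qed.

(** * Random strings *)

Definition bitw (R : realType) (p : R) (b : bool) : R := if b then p else 1 - p.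

Definition wordw (R : realType) (p : R) (k : nat) (r : k.-tuple bool) : R :=
  \prod_(b <- r) bitw p b.

Lemma wordw_ge0 (R : realType) (p : R) k (r : k.-tuple bool) :
  0 <= p <= 1 -> 0 <= wordw p r.
Proof.
by move=> /andP[p0 p1]; apply: prodr_ge0 => b _; rewrite /bitw; case: b; rewrite ?subr_ge0.
Qed.

Lemma sum_wordw (R : realType) (p : R) k : \sum_(r : k.-tuple bool) wordw p r = 1.
Proof.
elim: k => [|k IH]; first by rewrite sum_tuple0 /wordw big_nil.
rewrite sum_tupleS big_bool /wordw /=.
under eq_bigr do rewrite big_cons.
under [X in _ + X]eq_bigr do rewrite big_cons.
by rewrite -!big_distrr /= -/(wordw p _) IH; rewrite /bitw; ring.
Qed.

(** The finite data on which the fill ratio at level [k] depends. *)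
Definition table (n k : nat) (s : nat -> nat -> bool) : n.-tuple (k.-tuple bool) :=
  [tuple [tuple s i j | j < k] | i < n].

Lemma shared_prefixesE (n k : nat) (s : nat -> nat -> bool) (R : realType) :
  (shared_prefixes n s k)%:R =
  2 ^+ k - \sum_(r : k.-tuple bool) (count_lt 2 r (table n k s))%:R :> R.
Proof.
have cE (r : k.-tuple bool) :
    #|[pred i : 'I_n | is_prefix r (s i)]| = count_mem r (table n k s).
  rewrite -sum1_card -sum1_count big_tuple /=; apply: eq_bigl => i.
  rewrite inE tnth_mktuple /is_prefix; apply/forallP/eqP => [h|<- j].
    by apply: eq_from_tnth => j; rewrite tnth_mktuple; exact/eqP/h.
  by rewrite tnth_mktuple.
have -> : 2 ^+ k = \sum_(r : k.-tuple bool) 1%:R :> R.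
  by rewrite sumr_const card_tuple card_bool natrX.
rewrite -sumrB /shared_prefixes -sum1_card natr_sum big_mkcond.
apply: eq_bigr => r _; rewrite inE cE /count_lt ltnS.
by case: leqP => _ /=; rewrite ?subrr ?subr0.
Qed.

(** Deleting the last bit of a shared word leaves a shared word, and the word is recovered from the
    shortened one and the deleted bit. *)
Lemma shared_prefixes_double (n k : nat) (s : nat -> nat -> bool) :
  (shared_prefixes n s k.+1 <= 2 * shared_prefixes n s k)%N.
Proof.
pose f (r : k.+1.-tuple bool) : k.-tuple bool * bool :=
  ([tuple tnth r (widen_ord (leqnSn k) j) | j < k], tnth r ord_max).
have finj : injective f.
  move=> r t E; have h1 := congr1 fst E; have h2 : tnth r ord_max = tnth t ord_max := congr1 snd E.
  apply: eq_from_tnth => j.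
  have [jk|jk] := ltnP j k; last first.
    rewrite (_ : j = ord_max)//; apply: val_inj; apply/eqP.
    by rewrite eqn_leq jk -ltnS ltn_ord.
  have := congr1 (fun u : k.-tuple bool => tnth u (Ordinal jk)) h1.
  rewrite /f [fst _]/= [fst (_, tnth t _)]/=.
  rewrite !tnth_mktuple (_ : widen_ord _ _ = j)//; exact: val_inj.
rewrite /shared_prefixes.
set A := [pred r : k.+1.-tuple bool | _]; set B := [pred r : k.-tuple bool | _].
rewrite -(fintype.card_image finj A) mulnC -card_bool.
rewrite -fintype.cardX; apply: subset_leq_card.
apply/fintype.subsetP => u /fintype.imageP[r rA ->]; rewrite !inE andbT.
move: rA; rewrite !inE => /leq_trans; apply; apply: subset_leq_card.
apply/fintype.subsetP => i; rewrite !inE => /forallP h.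
by apply/forallP => j; rewrite tnth_mktuple -(eqP (h (widen_ord (leqnSn k) j))).
Qed.

Lemma fill_ratioS (R : realType) (n k : nat) (s : nat -> nat -> bool) :
  fill_ratio R n s k.+1 <= fill_ratio R n s k.
Proof.
rewrite /fill_ratio exprS invfM mulrA ler_pM2r ?invr_gt0 ?exprn_gt0//.
rewrite ler_pdivrMr// mulrC -(natrM _ 2) ler_nat; exact: shared_prefixes_double.
Qed.

Lemma fill_ratio_le (R : realType) (n k l : nat) (s : nat -> nat -> bool) :
  (k <= l)%N -> fill_ratio R n s l <= fill_ratio R n s k.
Proof.
move=> /subnKC <-; elim: (l - k)%N => [|m IH]; first by rewrite addn0.
by rewrite addnS (le_trans (fill_ratioS _ _ _ _)).
Qed.

(* Only levels [K] and [K + 2] matter, since the fill ratio is nonincreasing. *)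
Lemma fillup_levelP (R : realType) (alpha : R) (n K : nat) (s : nat -> nat -> bool) :
  (exists2 m, is_fillup_level alpha n s m & m = K \/ m = K.+1) <->
  alpha <= fill_ratio R n s K /\ fill_ratio R n s K.+2 < alpha.
Proof.
split=> [[m [/= am mub] mK]|[aK aK2]].
  split; first by apply: le_trans am _; apply: fill_ratio_le; case: mK => ->.
  rewrite ltNge; apply/negP => /mub; rewrite leEnat.
  by case: mK => ->; rewrite ?ltnn// ltnNge leqnSn.
have ub l : alpha <= fill_ratio R n s l -> (l <= K.+1)%N.
  move=> al; rewrite leqNgt; apply/negP => /(fill_ratio_le R n s).
  by move=> /(le_trans al); rewrite leNgt aK2.
have [aK1|aK1] := leP alpha (fill_ratio R n s K.+1).
  by exists K.+1; [split|right].
exists K; [split=> // l /= al|by left].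
have := ub l al; rewrite leq_eqVlt ltnS => /orP[/eqP lK|//].
by move: al; rewrite lK leNgt aK1.
Qed.

(** * Joint law of the number of strings and their first bits *)

Section Cells.
Context (R : realType) (d : measure_display) (T : measurableType d)
  (P : probability T R) (lambda p : R) (N : {RV P >-> nat})
  (xi : nat -> nat -> {RV P >-> bool}).
Hypotheses (l0 : 0 < lambda) (p01 : 0 <= p <= 1)
  (Hxi : poisson_random_strings lambda p N xi).

Let tab n k (x : T) := table n k (fun i j => xi i j x).

Lemma cond_prob_bit n (i : 'I_n) j b :
  cond_prob P (N @^-1` [set n]) (xi i j @^-1` [set b]) = bitw p b.
Proof.
have [HN /(_ n)[_ Hp]] := Hxi.
have mN : measurable (N @^-1` [set n]) by rewrite -[_ @^-1` _]setTI; exact: measurable_funP.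
have mX b' : measurable (xi i j @^-1` [set b']).
  by rewrite -[_ @^-1` _]setTI; exact: measurable_funP.
case: b; first exact: Hp.
have p0 : 0 < poisson_pmf lambda n.
  by rewrite /poisson_pmf l0 !mulr_gt0 ?exprn_gt0 ?invr_gt0 ?expR_gt0// ltr0n fact_gt0.
have := Hp i j; rewrite /cond_prob HN /= => E.
have -> : xi i j @^-1` [set false] `&` N @^-1` [set n] =
    N @^-1` [set n] `\` xi i j @^-1` [set true].
  by apply/seteqP; split => x /= [] h1 h2; split => //; move: h1 h2; case: (xi i j x).
have f1 : P (N @^-1` [set n] `\` xi i j @^-1` [set true]) \is a fin_num.
  by apply: fin_num_measure; exact: measurableD.
rewrite setIC in E.
have f2 : P (N @^-1` [set n] `&` xi i j @^-1` [set true]) \is a fin_num.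
  by apply: fin_num_measure; exact: measurableI.
have D : (P (N @^-1` [set n] `\` xi i j @^-1` [set true]) +
    P (N @^-1` [set n] `&` xi i j @^-1` [set true]))%E = (poisson_pmf lambda n)%:E.
  by rewrite -HN; apply/esym/measureDI.
move: D; rewrite -(fineK f1) -(fineK f2) -EFinD => -[] D.
rewrite -E -[1 in RHS](divff (lt0r_neq0 p0)) -mulrBl; congr (_ / _).
by rewrite -D addrK.
Qed.

Definition cell n k (t : n.-tuple (k.-tuple bool)) : set T :=
  N @^-1` [set n] `&` [set x | tab n k x = t].

(** Writes the cell as a finite intersection of single-bit events, the form to which
    [mutually_independent] applies. *)
Lemma cellE n k (t : n.-tuple (k.-tuple bool)) :
  cell t = (\bigcap_(u in [set` [fset u in [seq (i, j) | i <- enum 'I_n, j <- iota 0 k]]%fset])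
      ((xi u.1 u.2 : T -> bool) @^-1` [set nth false (tnth t u.1) u.2]))
    `&` N @^-1` [set n].
Proof.
rewrite /cell setIC; congr (_ `&` _); apply/seteqP; split => [x /= xt [i j]|x /= H].
  rewrite /= !inE => /allpairsP[[i' j'] /= [_ + [-> ->]]].
  rewrite mem_iota add0n => /andP[_ jk].
  by rewrite -xt tnth_mktuple (nth_mktuple _ _ (Ordinal jk)).
apply: eq_from_tnth => i; apply: eq_from_tnth => j.
rewrite !tnth_mktuple (tnth_nth false).
apply: (H (i, val j)); rewrite /= !inE; apply/allpairsP; exists (i, val j).
by rewrite mem_enum mem_iota /= add0n ltn_ord.
Qed.

Lemma measurable_cell n k (t : n.-tuple (k.-tuple bool)) : measurable (cell t).
Proof.
rewrite cellE; apply: measurableI; last first.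
  by rewrite -[_ @^-1` _]setTI; exact: measurable_funP.
apply: fin_bigcap_measurable; first exact: finite_fset.
by move=> u _; rewrite -[_ @^-1` _]setTI; exact: measurable_funP.
Qed.

Lemma measure_cell n k (t : n.-tuple (k.-tuple bool)) :
  P (cell t) = (poisson_pmf lambda n * \prod_(x <- t) wordw p x)%:E.
Proof.
have p0 : 0 < poisson_pmf lambda n.
  by rewrite /poisson_pmf l0 !mulr_gt0 ?exprn_gt0 ?invr_gt0 ?expR_gt0// ltr0n fact_gt0.
have [HN /(_ n)[+ _]] := Hxi.
move=> /(_ [fset u in [seq (i, j) | i <- enum 'I_n, j <- iota 0 k]]%fset
  (fun u => [set nth false (tnth t u.1) u.2]) (fun=> I)).
rewrite {1}/cond_prob -cellE HN /= => E.
have f1 : P (cell t) \is a fin_num by apply: fin_num_measure; exact: measurable_cell.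
rewrite -(fineK f1); congr EFin.
rewrite -[LHS](mulfVK (lt0r_neq0 p0)) E mulrC; congr (_ * _).
under eq_bigr do rewrite cond_prob_bit.
rewrite (perm_big [seq (i, j) | i <- enum 'I_n, j <- iota 0 k]) /=; last first.
  apply: uniq_perm; first exact: fset_uniq.
    by apply: allpairs_uniq; rewrite ?enum_uniq ?iota_uniq// => -[? ?] [? ?].
  by move=> u; rewrite !inE.
rewrite big_allpairs_dep /= big_enum big_tuple /=; apply: eq_bigr => i _.
rewrite /wordw (big_nth false) size_tuple big_mkord -[X in iota X]/0%N.
by rewrite -(big_mkord xpredT (fun j => bitw p (nth false (tnth t i) j))) /index_iota subn0.
Qed.

End Cells.

(** * Events determined by the table of bits *)

Section Events.
Context (R : realType) (d : measure_display) (T : measurableType d)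
  (P : probability T R) (lambda p : R) (N : {RV P >-> nat})
  (xi : nat -> nat -> {RV P >-> bool}).
Hypotheses (l0 : 0 < lambda) (p01 : 0 <= p <= 1)
  (Hxi : poisson_random_strings lambda p N xi).

Let tab n k (x : T) := table n k (fun i j => xi i j x).

Let slice k (Q : nat -> seq (k.-tuple bool) -> bool) n : set T :=
  \bigcup_(t in [set` [seq t : n.-tuple (k.-tuple bool) <- enum {: n.-tuple (k.-tuple bool)} | Q n t]]) cell N xi t.

Let measurable_slice k (Q : nat -> seq (k.-tuple bool) -> bool) n :
  measurable (slice Q n).
Proof.
apply: fin_bigcup_measurable; first exact: finite_seq.
by move=> t _; exact: measurable_cell.
Qed.

Let eventE k (Q : nat -> seq (k.-tuple bool) -> bool) :
  [set x | Q (N x) (tab (N x) k x)] = \bigcup_n slice Q n.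
Proof.
apply/seteqP; split=> [x /= Qx|x [n _ [t]]].
  exists (N x) => //; exists (tab (N x) k x) => //=.
  by rewrite mem_filter Qx mem_enum.
rewrite /= mem_filter => /andP[Qt _] [/= Nx xt].
have : Q n (tab n k x) by rewrite /tab xt.
by rewrite -Nx.
Qed.

Lemma measurable_event k (Q : nat -> seq (k.-tuple bool) -> bool) :
  measurable [set x | Q (N x) (tab (N x) k x)].
Proof. by rewrite eventE; apply: bigcup_measurable => n _; exact: measurable_slice. Qed.

(** The event is split over the value of [N], countably subadditively, then over the finitely many
    disjoint cells of each value. *)
Lemma event_bound k (Q : seq (k.-tuple bool) -> bool) (B : R) :
  (forall n, \sum_(0 <= i < n) poisson_pmf lambda i *
     iid (@wordw R p k) i (fun s => (Q s)%:R) <= B) ->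
  (P [set x | Q (tab (N x) k x)] <= B%:E)%E.
Proof.
move=> HB; have E := @eventE k (fun=> Q); rewrite /= in E.
have mE := @measurable_event k (fun=> Q).
have sub : [set x | Q (tab (N x) k x)] `<=` \bigcup_n slice (fun=> Q) n by rewrite E.
apply: le_trans (measure_sigma_subadditive P (measurable_slice (fun=> Q)) mE sub) _.
have PE n : P (slice (fun=> Q) n) =
    (poisson_pmf lambda n * iid (@wordw R p k) n (fun s => (Q s)%:R))%:E.
  have tr : trivIset [set` [seq t : n.-tuple (k.-tuple bool) <- enum {: n.-tuple (k.-tuple bool)} | Q t]]
      (fun t => cell N xi t).
    by move=> t u _ _ [x [[_ /= <-] [_ /= <-]]].
  rewrite /slice (measure_fin_bigcup P (finite_seq _) tr); last first.
    by move=> t _; exact: measurable_cell.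
  rewrite -fsbig_seq; last by apply: filter_uniq; exact: enum_uniq.
  rewrite big_filter big_enum_cond /=.
  under eq_bigr do rewrite (measure_cell l0 Hxi).
  rewrite sumEFin; congr EFin; rewrite /iid big_distrr big_mkcond.
  by apply: eq_bigr => t _ /=; case: (Q t); rewrite ?mulr1 ?mulr0.
apply: lime_le; first by apply: is_cvg_nneseries => n _ _; exact: measure_ge0.
apply: nearW => n; rewrite (eq_bigr _ (fun i _ => PE i)).
by rewrite sumEFin lee_fin.
Qed.

End Events.

Definition fill_mean (R : realType) (lambda p : R) (k : nat) : R :=
  (\sum_(r : k.-tuple bool) psi (lambda * wordw p r)) / 2 ^+ k.

Lemma fill_ratioE (R : realType) (n k : nat) (s : nat -> nat -> bool) (lambda p : R) :
  fill_ratio R n s k - fill_mean lambda p k =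
  - (\sum_r (count_lt 2 r (table n k s))%:R -
     \sum_(r : k.-tuple bool) (1 + lambda * wordw p r) * expR (- (lambda * wordw p r))) / 2 ^+ k.
Proof.
rewrite /fill_ratio shared_prefixesE /fill_mean /psi sumrB sumr_const card_tuple card_bool.
rewrite natrX; ring.
Qed.

Lemma measurable_fill_ratio (R : realType) (d : measure_display) (T : measurableType d)
    (P : probability T R) (N : {RV P >-> nat}) (xi : nat -> nat -> {RV P >-> bool})
    (a : R) k :
  measurable [set x : T | a <= fill_ratio R (N x) (fun i j => xi i j x) k].
Proof.
have := @measurable_event R d T P N xi k
  (fun n t => a <= (2 ^+ k - \sum_r (count_lt 2 r t)%:R) / 2 ^+ k).
congr (measurable _); apply/funext => x /=.
by rewrite /fill_ratio shared_prefixesE.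
Qed.

(** Chebyshev for the count of unshared words, with variance at most [2 ^+ k] and deviation
    [delta * 2 ^+ k]. *)
Lemma fill_ratio_conc (R : realType) (d : measure_display) (T : measurableType d)
    (P : probability T R) (lambda p : R) (N : {RV P >-> nat})
    (xi : nat -> nat -> {RV P >-> bool}) (delta : R) k :
  0 < lambda -> 0 <= p <= 1 -> poisson_random_strings lambda p N xi -> 0 < delta ->
  let E := [set x : T | delta <=
    `|fill_ratio R (N x) (fun i j => xi i j x) k - fill_mean lambda p k|] in
  measurable E /\ (P E <= ((delta ^+ 2 * 2 ^+ k)^-1)%:E)%E.
Proof.
move=> l0 p01 H d0 E.
pose D := delta * 2 ^+ k; have D0 : 0 < D by rewrite mulr_gt0 ?exprn_gt0.
pose Q (t : seq (k.-tuple bool)) := D <= `|\sum_r (count_lt 2 r t)%:R -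
     \sum_(r : k.-tuple bool) (1 + lambda * wordw p r) * expR (- (lambda * wordw p r))|.
have EQ : E = [set x | Q (table (N x) k (fun i j => xi i j x))].
  apply/funext => x; rewrite /E /Q /= fill_ratioE normrM normrN normfV.
  by rewrite (@ger0_norm _ (2 ^+ k)) ?exprn_ge0// ler_pdivlMr ?exprn_gt0.
rewrite EQ; split; first exact: (@measurable_event R d T P N xi k (fun=> Q)).
apply: (@event_bound R d T P lambda p N xi l0 H) => n.
have := @pois_chebyshev R lambda {: k.-tuple bool} (@wordw R p k) D n l0.
move=> /(_ (fun x => wordw_ge0 x p01) (sum_wordw p k) D0) /le_trans; apply.
rewrite card_tuple card_bool natrX /D exprMn le_eqVlt; apply/orP; left; apply/eqP.
have h2 : 2 ^+ k != 0 :> R by rewrite expf_neq0.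
have hd : delta != 0 by rewrite gt_eqF.
by field; rewrite ?h2 ?hd.
Qed.

(** * The fill-up level *)

Lemma walkN (R : realType) n (g : R -> R) : walk n (fun s => g (- s)) = walk n g.
Proof.
elim: n g => [|n IH] g /=; first by rewrite oppr0.
rewrite -[RHS]IH; apply: eq_walk => s.
by rewrite opprD opprB addrC [1 - s]addrC.
Qed.

(** The first bit is absorbed into [lambda], over which the induction is therefore generalized; a
    bit 1 moves the walk up and a bit 0 moves it down. *)
Lemma sum_words_walk (R : realType) (p : R) (G : R -> R) k (lambda : R) :
  0 < p < 1 -> 0 < lambda ->
  (\sum_(r : k.-tuple bool) G (lambda * wordw p r)) / 2 ^+ k =
  walk k (fun s => G (expR (ln lambda - (- (ln p + ln (1 - p)) / 2) * k%:R +
    (ln p - ln (1 - p)) / 2 * s))).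
Proof.
move=> /andP[p0 p1]; have q0 : 0 < 1 - p by rewrite subr_gt0.
elim: k lambda => [|k IH] lambda l0.
  rewrite sum_tuple0 /wordw big_nil mulr1 expr0 divr1 /=.
  by rewrite !mulr0 subr0 addr0 lnK.
rewrite sum_tupleS big_bool /= exprS invfM mulrCA mulrDl.
have cons b : \sum_(t : k.-tuple bool) G (lambda * wordw p [tuple of b :: t]) =
    \sum_(t : k.-tuple bool) G (lambda * bitw p b * wordw p t).
  by apply: eq_bigr => t _; rewrite /wordw big_cons mulrA.
rewrite !cons !IH ?mulr_gt0// -walkD -walkZ.
apply: eq_walk => s; rewrite [RHS]mulrC /bitw !lnM ?posrE//; congr (_ * (G (expR _) + G (expR _))).
  by rewrite -(natr1 k); field.
by rewrite -(natr1 k); field.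
Qed.

(** The symmetry of the walk allows the absolute value of [ln p - ln (1 - p)]. *)
Lemma fill_meanE (R : realType) (p lambda : R) k : 0 < p < 1 -> 0 < lambda ->
  fill_mean lambda p k =
  fill (- (ln p + ln (1 - p)) / 2) (`|ln p - ln (1 - p)| / 2) (ln lambda) k.
Proof.
move=> p01 l0; rewrite /fill_mean (@sum_words_walk R p (@psi R) k lambda p01 l0) /fill.
set h := ln p - _; have [h0|h0] := leP 0 h; first by rewrite ger0_norm.
rewrite ltr0_norm// -[LHS]walkN; apply: eq_walk => s.
by congr (psi (expR (_ + _))); ring.
Qed.

(** * Inverse of the normal distribution function *)

Lemma Phi_surj (R : realType) (alpha : R) : 0 < alpha < 1 -> exists x, Phi x = alpha.
Proof.
move=> /andP[a0 a1].
have [a ha] : exists a : R, Phi a <= alpha.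
  have /cvgrPdist_lt/(_ alpha a0) [M [_ hM]] := @Phi_cvg_ninfty R.
  exists (M - 1); have := hM (M - 1); rewrite ltrBlDr ltrDl ltr01 => /(_ isT).
  by rewrite sub0r normrN ger0_norm ?Phi_ge0// => /ltW.
have [b hb] : exists b : R, alpha <= Phi b.
  have e0 : 0 < 1 - alpha by rewrite subr_gt0.
  have /cvgrPdist_lt/(_ _ e0) [M [_ hM]] := @Phi_cvg_pinfty R.
  exists (M + 1); have := hM (M + 1); rewrite ltrDl ltr01 => /(_ isT).
  by rewrite ger0_norm ?subr_ge0 ?Phi_le1//; lra.
have [ab|ba] := leP a b; last first.
  by exists a; apply/le_anti; rewrite ha (le_trans hb)// Phi_le// ltW.
have [||x _ <-] := @IVT R (@Phi R) a b alpha ab.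
- apply: continuous_subspaceT => x.
  have := is_derive_Phi x => /@ex_derive h.
  by apply: differentiable_continuous; apply/derivable1_diffP.
- by rewrite ge_min ha le_max hb orbT.
- by exists x.
Qed.

Lemma Phi_invK (R : realType) (alpha : R) : 0 < alpha < 1 -> Phi (Phi_inv alpha) = alpha.
Proof.
move=> /Phi_surj[x xa]; rewrite /Phi_inv.
exact: (@xgetPex R 0 [set y | Phi y = alpha] (ex_intro _ x xa)).
Qed.

(** [K.+1] is the first level from [k1] on at which [f] is below [a + d]. One more level lowers [f]
    by [2 * d], hence to at most [a - d]. *)
Lemma fill_select (R : realType) (f : nat -> R) (c M a d : R) :
  0 < M -> M + 3 <= c -> 0 <= d ->
  (forall k : nat, `|k%:R - c| <= M + 3 ->
     [/\ c + M <= k%:R -> f k < a, k%:R <= c - M -> a + d <= f k &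
         2 * d <= f k - f k.+1]) ->
  exists K : nat, [/\ c - (M + 3) <= K%:R, `|K%:R - c| <= M + 3,
    a + d <= f K & f K.+2 <= a - d].
Proof.
move=> M0 Mc d0 H.
have cM0 : 0 <= c - M by lra.
have cM1 : 0 <= c + M by lra.
have /andP[k1l k1u] := truncn_itv cM0; have /andP[k2l k2u] := truncn_itv cM1.
(* Rounding down at [c - M] and strictly up at [c + M] puts [k1] where [f] is still high and [k2]
   where it is already low. *)
set k1 := Num.truncn (c - M) in k1l k1u *; set k2 := (Num.truncn (c + M)).+1 in k2u *.
rewrite -natr1 in k1u.
have k2c : k2%:R <= c + M + 1 by rewrite /k2 -natr1 lerD2r.
pose Q k := (k1 <= k)%N && (f k < a + d).
have Qk2 : Q k2.
  apply/andP; split.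
    by rewrite -(ler_nat R); lra.
  have [|h _ _] := H k2; first by rewrite ler_norml; lra.
  by apply: lt_le_trans (h (ltW k2u)) _; rewrite lerDl.
have exQ : exists k, Q k by exists k2.
have [k /andP[k1k fk] kmin] := ex_minnP exQ.
have kk2 : (k <= k2)%N by exact: kmin.
have k1P : a + d <= f k1.
  by have [|_ h _] := H k1; [rewrite ler_norml; lra | exact: h].
have k1k' : (k1 < k)%N.
  rewrite ltn_neqAle k1k andbT; apply/eqP => E.
  by move: fk; rewrite -E ltNge k1P.
case: k k1k fk kmin kk2 k1k' => // K k1K fK kmin kk2; rewrite ltnS => k1K'.
have r1 : k1%:R <= K%:R :> R by rewrite ler_nat.
have r2 : K.+1%:R <= k2%:R :> R by rewrite ler_nat.
have r3 : K.+1%:R = K%:R + 1 :> R by rewrite natr1.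
exists K; split.
- lra.
- by rewrite ler_norml; lra.
- rewrite leNgt; apply/negP => fK'.
  by have := kmin K; rewrite /Q k1K' fK' ltnn => /(_ isT).
- have [|_ _ g] := H K.+1; first by rewrite ler_norml; lra.
  lra.
Qed.

(** The Chebyshev error at [delta = rho^-2] is of order [rho^4 / 2 ^+ K] with [K >= rho^2 / 2]; a
    cubic bound on [2 ^+ K] makes it [O(1 / ln lambda)]. *)
Lemma pow2_ge (R : realType) (n : nat) : (ln 2) ^+ 3 / 6 * n%:R ^+ 3 <= 2 ^+ n :> R.
Proof.
have l2 : 0 <= ln (2 : R) by rewrite ln_ge0// ler1n.
have := @expR_ge1Dxn R (ln 2 * n%:R) 2; rewrite mulr_ge0// => /(_ isT).
rewrite (mulrC (ln 2)) expRM_natl lnK ?posrE// => h.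
apply: le_trans h; rewrite (_ : 3`!%:R = 6 :> R)// exprMn.
lra.
Qed.

(** By [fillup_levelP], failure forces a deviation of at least [delta] from the mean at level [K] or
    [K.+2]; the union bound gives the factor 2. *)
Lemma fillup_level_prob (R : realType) (d : measure_display) (T : measurableType d)
    (P : probability T R) (lambda p : R) (N : {RV P >-> nat})
    (xi : nat -> nat -> {RV P >-> bool}) (alpha delta : R) (K : nat) :
  0 < lambda -> 0 <= p <= 1 -> poisson_random_strings lambda p N xi -> 0 < delta ->
  alpha + delta <= fill_mean lambda p K ->
  fill_mean lambda p K.+2 <= alpha - delta ->
  ((1 - 2 / (delta ^+ 2 * 2 ^+ K))%R%:E <=
  P [set w : T | exists2 m : nat,
       is_fillup_level alpha (N w) (fun i j => xi i j w) m &
       (m%:Z = K%:Z \/ m%:Z = K%:Z + 1)%R] <= 1)%E.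
Proof.
move=> l0 p01 H d0 fK fK2; set E := [set w | _].
pose A k := [set x : T | alpha <= fill_ratio R (N x) (fun i j => xi i j x) k].
have EA : E = A K `&` ~` A K.+2.
  apply/seteqP; split=> x.
    move=> [m lm mK]; have [a b] : A K x /\ fill_ratio R (N x) (fun i j => xi i j x) K.+2 < alpha.
      apply/fillup_levelP; exists m => //; case: mK => [[->]|]; first by left.
      by rewrite -PoszD addn1 => -[->]; right.
    by split=> //; apply/negP; rewrite -ltNge.
  move=> [/= a /negP]; rewrite -ltNge => b.
  have /fillup_levelP[m lm mK] : alpha <= fill_ratio R (N x) (fun i j => xi i j x) K /\
    fill_ratio R (N x) (fun i j => xi i j x) K.+2 < alpha by split.
  exists m => //; case: mK => ->; [by left|right].
  by rewrite -PoszD addn1.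
have mA k : measurable (A k) by exact: measurable_fill_ratio.
have mE : measurable E by rewrite EA; apply: measurableI => //; exact: measurableC.
have [mB1 B1] := fill_ratio_conc K l0 p01 H d0.
have [mB2 B2] := fill_ratio_conc K.+2 l0 p01 H d0.
set C1 := [set x | _] in mB1 B1; set C2 := [set x | _] in mB2 B2.
have sub : ~` E `<=` C1 `|` C2.
  move=> x; rewrite EA setCI setCK => -[/negP|] /=; rewrite -?ltNge => h; [left|right].
    rewrite /C1 /= distrC ler_normr; apply/orP; left.
    by rewrite lerBrDl (le_trans _ fK)// lerD2r ltW.
  rewrite /C2 /= ler_normr; apply/orP; left.
  by rewrite lerBrDr (le_trans _ h)// -lerBrDl.
have D0 : 0 < delta ^+ 2 * 2 ^+ K by rewrite mulr_gt0 ?exprn_gt0.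
have PC : (P (~` E) <= (2 / (delta ^+ 2 * 2 ^+ K))%:E)%E.
  apply: (@le_trans _ _ (P (C1 `|` C2))).
    by apply: le_measure => //; rewrite inE; [exact: measurableC|exact: measurableU].
  apply: (le_trans (measureU2 P mB1 mB2)); apply: (le_trans (leeD B1 B2)).
  rewrite -EFinD lee_fin mulrDl mul1r lerD2l lef_pV2 ?posrE//.
    by rewrite ler_pM2l ?exprn_gt0// ler_eXn2l ?ltr1n// ltnW// ltnW.
  by rewrite mulr_gt0 ?exprn_gt0.
rewrite probability_le1// andbT.
have := probability_setC P (measurableC mE); rewrite setCK => ->.
by rewrite EFinB leeB.
Qed.

Lemma fill_params (R : realType) (p : R) : 0 < p < 1 ->
  let ell := - (ln p + ln (1 - p)) / 2 in
  let h := `|ln p - ln (1 - p)| / 2 in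
  [/\ 0 <= h, h < ell, ln (1 / Num.sqrt (p * (1 - p))) = ell &
      `|ln (p / (1 - p))| = 2 * h].
Proof.
move=> /andP[p0 p1] ell h; have q0 : 0 < 1 - p by rewrite subr_gt0.
have lp : ln p < 0 by rewrite ln_lt0// p0.
have lq : ln (1 - p) < 0 by rewrite ln_lt0// q0 gtrBl.
have h0 : 0 <= h by rewrite divr_ge0.
split=> //.
- have : `|ln p - ln (1 - p)| < - (ln p + ln (1 - p)) by rewrite ltr_norml; lra.
  by rewrite /h /ell; lra.
- rewrite div1r lnV ?posrE ?sqrtr_gt0 ?mulr_gt0//.
  have pq0 : 0 < p * (1 - p) by rewrite mulr_gt0.
  have E : ln (Num.sqrt (p * (1 - p)) ^+ 2) = ln p + ln (1 - p).
    by rewrite sqr_sqrtr ?ltW// lnM.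
  move: E; rewrite lnXn ?sqrtr_gt0// mulr2n /ell => E; lra.
- by rewrite ln_div ?posrE// /h; field.
Qed.

Lemma powR_three_halves (R : realType) (x : R) : 0 < x -> x `^ (3 / 2) = x * Num.sqrt x.
Proof.
move=> x0; rewrite (_ : 3 / 2 = 1 + 2^-1 :> R); last by field.
by rewrite powRD ?gt_eqF ?implybT// powRr1 ?ltW// powR12_sqrt// ltW.
Qed.

Lemma centerE (R : realType) (ell h z lambda : R) : 0 < ell -> 0 <= ln lambda ->
  let rho := Num.sqrt (ln lambda / ell) in
  ell * rho ^+ 2 = ln lambda /\
  ln lambda / ell - 2 * h / (2 * ell `^ (3 / 2)) * z * Num.sqrt (ln lambda) =
  rho ^+ 2 - h * z / ell * rho.
Proof.
move=> l0 L0 rho; have r2 : rho ^+ 2 = ln lambda / ell by rewrite sqr_sqrtr// divr_ge0// ltW.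
split; first by rewrite r2 mulrC divfK// gt_eqF.
have s0 : 0 < Num.sqrt ell by rewrite sqrtr_gt0.
have -> : Num.sqrt (ln lambda) = Num.sqrt ell * rho.
  by rewrite -sqrtrM ?ltW// mulrC divfK// gt_eqF.
rewrite r2 powR_three_halves//; congr (_ - _).
by field; rewrite !gt_eqF.
Qed.

Theorem theorem3 (R : realType) (alpha p q : R)
    (halpha : 0 < alpha < 1) (hp : 0 < p < 1) (hq : q = 1 - p) :
  exists (C : R) (k : R -> int),
    (forall lambda : R, 0 < lambda ->
       `| (k lambda)%:~R
          - (logb (1 / Num.sqrt (p * q)) lambda
             - `| ln (p / q) | / (2 * ln (1 / Num.sqrt (p * q)) `^ (3 / 2))
               * Phi_inv alpha * Num.sqrt (ln lambda)) | <= C) /\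
    (forall (d : R -> measure_display)
            (T : forall lambda : R, measurableType (d lambda))
            (P : forall lambda : R, probability (T lambda) R)
            (N : forall lambda : R, {RV (P lambda) >-> nat})
            (xi : forall lambda : R, nat -> nat -> {RV (P lambda) >-> bool}),
       (forall lambda : R, 0 < lambda ->
          poisson_random_strings lambda p (N lambda) (xi lambda)) ->
       P lambda [set w : T lambda | exists2 m : nat,
          is_fillup_level alpha (N lambda w)
            (fun i j => xi lambda i j w) m &
          m%:Z = k lambda \/ m%:Z = k lambda + 1]
         @[lambda --> +oo] --> 1%E).
Proof.
subst q; have p01 := hp; have [h0 hl lE hE] := fill_params hp.
set ell := - _ / 2 in hl lE; set h := `|_| / 2 in h0 hl hE.
set z := Phi_inv alpha; have za : Phi z = alpha by exact: Phi_invK.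
have l0 : 0 < ell by exact: le_lt_trans hl.
have [M [rho0 [M0 rho02 loc]]] := fill_location h0 hl halpha za.
pose c lambda := ln lambda / ell - 2 * h / (2 * ell `^ (3 / 2)) * z * Num.sqrt (ln lambda).
pose lambda0 := expR (ell * rho0 ^+ 2).
have r00 : 0 <= ell * rho0 ^+ 2 by rewrite mulr_ge0 ?sqr_ge0// ltW.
have big lambda : lambda0 <= lambda ->
    [/\ 0 < lambda, 0 <= ln lambda & rho0 <= Num.sqrt (ln lambda / ell)].
  move=> ll; have lp : 0 < lambda by apply: lt_le_trans ll; exact: expR_gt0.
  have Ll : ell * rho0 ^+ 2 <= ln lambda by rewrite -ler_expR lnK// posrE.
  have L0 : 0 <= ln lambda by exact: le_trans Ll.
  have Ll0 : 0 <= ln lambda / ell by apply: divr_ge0 => //; exact: ltW.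
  split=> //; apply: le_trans (ler_norm rho0) _; rewrite -sqrtr_sqr ler_sqrt//.
  by rewrite ler_pdivlMr// mulrC.
(* The level is chosen from [lambda] alone, before any probability space is given. *)
have sel : forall lambda : R, exists k : int, 0 < lambda ->
    `|k%:~R - c lambda| <= M + 3 /\
    (lambda0 <= lambda -> exists K : nat, let rho := Num.sqrt (ln lambda / ell) in
       [/\ k = K%:Z, rho ^+ 2 / 2 <= K%:R,
           alpha + (rho ^+ 2)^-1 <= fill ell h (ln lambda) K &
           fill ell h (ln lambda) K.+2 <= alpha - (rho ^+ 2)^-1]).
  move=> lambda; have [ll|ll] := leP lambda0 lambda; last first.
    (* Below [lambda0] only the distance to the centre matters, so rounding it is enough. *)
    exists (Num.floor (c lambda)) => _; split=> //.
    have /andP[f1 f2] := floor_itv (c lambda).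
    rewrite ler_norml; move: f2; rewrite intrD mulr1z => f2; apply/andP; split; lra.
  have [lp L0 rl] := big _ ll; set rho := Num.sqrt _ in rl *.
  have [Er Ec] := centerE h z l0 L0; rewrite -/rho in Er Ec.
  have [loc1 loc2] := loc rho rl; rewrite Er in loc2.
  have rp : 0 < rho by apply: lt_le_trans rl; lra.
  have Mc : M + 3 <= rho ^+ 2 - h * z / ell * rho.
    by apply: le_trans loc1; rewrite lerDr divr_ge0// sqr_ge0.
  have d0 : 0 <= (rho ^+ 2)^-1 by rewrite invr_ge0 sqr_ge0.
  have [K [K1 K2 K3 K4]] := fill_select M0 Mc d0 loc2.
  exists K%:Z => _; split; first by rewrite /c Ec.
  by move=> _; exists K; split=> //; move: loc1 K1; lra.
have [k kP] := choice sel.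
exists (M + 3), k; split=> [lambda lp|d T P N xi H].
  by have [] := kP lambda lp; rewrite /c /logb lE hE.
(* Here 2 is the union bound, 48 is 6 from [pow2_ge] times 8 from cubing [rho^2 / 2], and [ell]
   converts [rho^2] into [ln lambda]. *)
pose C := 2 * (48 / ln 2 ^+ 3) * ell.
have ln20 : 0 < ln (2 : R) by rewrite ln_gt0// ltr1n.
have l23 : 0 < ln (2 : R) ^+ 3 by rewrite exprn_gt0.
have C0 : 0 < C by apply: mulr_gt0 => //; apply: mulr_gt0 => //; rewrite divr_gt0.
have bound : forall lambda : R, lambda0 <= lambda -> ((1 - C / ln lambda)%R%:E <=
    P lambda [set w : T lambda | exists2 m : nat,
      is_fillup_level alpha (N lambda w) (fun i j => xi lambda i j w) m &
      (m%:Z = k lambda \/ m%:Z = k lambda + 1)%R] <= 1)%E.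
  move=> lambda ll; have [lp L0 rl] := big _ ll.
  have [_ /(_ ll)[K /= [-> K1 K2 K3]]] := kP lambda lp.
  have [Er _] := centerE h z l0 L0.
  set rho := Num.sqrt _ in rl Er K1 K2 K3.
  have rp : 0 < rho by apply: lt_le_trans rl; lra.
  have r2 : 0 < rho ^+ 2 by rewrite exprn_gt0.
  have p01' : 0 <= p <= 1 by case/andP: p01 => ? ?; rewrite !ltW.
  have d0 : 0 < (rho ^+ 2)^-1 by rewrite invr_gt0.
  have := fillup_level_prob lp p01' (H _ lp) d0; rewrite -!fill_meanE// in K2 K3 *.
  move=> /(_ alpha K K2 K3)/andP[low ->]; rewrite andbT; apply: le_trans low.
  rewrite lee_fin lerD2l lerN2.
  have P2 := pow2_ge R K.
  have K3' : (rho ^+ 2 / 2) ^+ 3 <= K%:R ^+ 3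
    by rewrite lerXn2r ?nnegrE ?ler0n//; lra.
  have B : ln 2 ^+ 3 / 48 * (rho ^+ 2) ^+ 3 <= 2 ^+ K.
    apply: le_trans P2; have : ln 2 ^+ 3 / 6 * (rho ^+ 2 / 2) ^+ 3 <= ln 2 ^+ 3 / 6 * K%:R ^+ 3 :> R.
      by rewrite ler_pM2l// divr_gt0.
    by apply: le_trans; rewrite le_eqVlt; apply/orP; left; apply/eqP; field.
  have B0 : 0 < ln 2 ^+ 3 / 48 * (rho ^+ 2) ^+ 3.
    by apply: mulr_gt0; [rewrite divr_gt0|rewrite exprn_gt0].
  have -> : C / ln lambda = 2 / ((rho ^+ 2)^-1 ^+ 2 * (ln 2 ^+ 3 / 48 * (rho ^+ 2) ^+ 3)).
    by rewrite -Er /C; field; rewrite !gt_eqF.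
  rewrite ler_pM2l// lef_pV2 ?posrE ?mulr_gt0 ?exprn_gt0//.
  by rewrite ler_pM2l// exprn_gt0.
apply: (@squeeze_cvge _ _ _ _ (fun lambda => (1 - C / ln lambda)%R%:E) _ (fun=> 1%E)).
- near=> lambda; apply: bound; near: lambda; exact: nbhs_pinfty_ge (num_real _).
- apply: cvg_EFin; first by near=> lambda.
  apply/cvgrPdist_le => e e0; near=> lambda.
  have Ll : C / e <= ln lambda.
    rewrite -ler_expR lnK; last by rewrite posrE; near: lambda; exact: nbhs_pinfty_gt (num_real _).
    by near: lambda; exact: nbhs_pinfty_ge (num_real _).
  have L0 : 0 < ln lambda by apply: lt_le_trans Ll; rewrite divr_gt0.
  rewrite /= (_ : 1 - (1 - C / ln lambda) = C / ln lambda); last by ring.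
  rewrite ger0_norm; last by apply: divr_ge0; exact: ltW.
  by rewrite ler_pdivrMr// mulrC -ler_pdivrMr.
- exact: cvg_cst.
Unshelve. all: end_near. Qed.
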